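(* Let $K\ge1$ and let $f=h+\overline{g}$ be a $K$-quasiregular harmonic mapping in the unit disk $\mathbb{D}$, with $h,g$ analytic in $\mathbb{D}$, such that $f(0)=0$ and $\lambda_f(0)=1$. If $|h(z)|\leq M$ for all $z\in\mathbb{D}$, where $M$ is a constant, then $M\geq 1$, $f$ is univalent in the disk $\mathbb{D}_{r_2}$ and $f(\mathbb{D}_{r_2})$ contains a schlicht disk $\mathbb{D}_{r_3}$, where $$r_2=\frac{K+1}{3\sqrt{3}\,KM}\quad\text{and}\quad r_3=\frac{\sqrt{3}\,KM}{K+1}\left(1+\left(\left(\frac{3KM}{K+1}\right)^2-1\right)\log\left(1-\frac{(K+1)^2}{9K^2M^2}\right)\right).$$
   Context: $\mathbb{D}_r(a)=\{z\in\mathbb{C}:|z-a|<r\}$, $\mathbb{D}_r=\mathbb{D}_r(0)$, $\mathbb{D}=\mathbb{D}_1$. A harmonic mapping in $\mathbb{D}$ is a complex-valued, twice continuously differentiable function $f$ with $4f_{z\bar z}=0$; it can be written $f=h+\overline{g}$ with $h,g$ analytic in $\mathbb{D}$. Put $\Lambda_f(z)=|f_z(z)|+|f_{\bar z}(z)|=|h'(z)|+|g'(z)|$, $\lambda_f(z)=\big||f_z(z)|-|f_{\bar z}(z)|\big|=\big||h'(z)|-|g'(z)|\big|$, and $J_f(z)=|h'(z)|^2-|g'(z)|^2$. The mapping $f$ is sense-preserving if $J_f>0$ in $\mathbb{D}$. A sense-preserving harmonic mapping $f$ is $K$-quasiregular ($K\ge1$) in $\mathbb{D}$ if $\Lambda_f(z)\le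 K\lambda_f(z)$ for all $z\in\mathbb{D}$. Univalent means injective. A disk $\mathbb{D}_\rho(a)$ is a schlicht disk of $f$ if there is a subdomain $\Omega\subset\mathbb{D}$ such that $f$ is univalent in $\Omega$ and $f(\Omega)=\mathbb{D}_\rho(a)$; ''$f(\mathbb{D}_r)$ contains a schlicht disk $\mathbb{D}_\rho$'' means that $\Omega$ can be taken inside $\mathbb{D}_r$. *)

(* Defs.v *)
From Stdlib Require Export Reals.
From Coquelicot Require Export Coquelicot.

Local Open Scope R_scope.

Definition disk (a : C) (r : R) : C -> Prop := fun z => Cmod (z - a) < r.

Definition unit_disk : C -> Prop := disk 0 1.

(* Complex differentiability at every point of the (open) set U. *)
Definition analytic_on (U : C -> Prop) (h : C -> C) : Prop :=
  forall z : C, U z -> @ex_derive C_AbsRing C_NormedModule h z.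

(* Partial derivatives of f = u + iv with respect to x = Re z and y = Im z;
   [Derive] is total, so these are meaningful only together with [ex_dx],
   [ex_dy]. *)
Definition dx (f : C -> C) (z : C) : C :=
  (Derive (fun t => Re (f (t, Im z))) (Re z),
   Derive (fun t => Im (f (t, Im z))) (Re z)).

Definition dy (f : C -> C) (z : C) : C :=
  (Derive (fun t => Re (f (Re z, t))) (Im z),
   Derive (fun t => Im (f (Re z, t))) (Im z)).

Definition ex_dx (f : C -> C) (z : C) : Prop :=
  ex_derive (fun t : R => Re (f (t, Im z))) (Re z) /\
  ex_derive (fun t : R => Im (f (t, Im z))) (Re z).

Definition ex_dy (f : C -> C) (z : C) : Prop :=
  ex_derive (fun t : R => Re (f (Re z, t))) (Im z) /\
  ex_derive (fun t : R => Im (f (Re z, t))) (Im z).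

Definition C1_on (U : C -> Prop) (f : C -> C) : Prop :=
  forall z : C, U z ->
    ex_dx f z /\ ex_dy f z /\ continuous (dx f) z /\ continuous (dy f) z.

Definition C2_on (U : C -> Prop) (f : C -> C) : Prop :=
  C1_on U f /\ C1_on U (dx f) /\ C1_on U (dy f).

(* Wirtinger derivatives f_z and f_{\bar z}. *)
Definition dz (f : C -> C) (z : C) : C := ((dx f z - Ci * dy f z) / 2)%C.

Definition dzbar (f : C -> C) (z : C) : C := ((dx f z + Ci * dy f z) / 2)%C.

Definition harmonic_on (U : C -> Prop) (f : C -> C) : Prop :=
  C2_on U f /\ forall z : C, U z -> (4 * dzbar (dz f) z)%C = 0.

Definition Lambda (f : C -> C) (z : C) : R :=
  Cmod (dz f z) + Cmod (dzbar f z).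

Definition lambda (f : C -> C) (z : C) : R :=
  Rabs (Cmod (dz f z) - Cmod (dzbar f z)).

Definition jacobian (f : C -> C) (z : C) : R :=
  Cmod (dz f z) ^ 2 - Cmod (dzbar f z) ^ 2.

Definition sense_preserving (f : C -> C) : Prop :=
  forall z : C, unit_disk z -> 0 < jacobian f z.

Definition quasiregular_harmonic (K : R) (f : C -> C) : Prop :=
  harmonic_on unit_disk f /\ sense_preserving f /\
  forall z : C, unit_disk z -> Lambda f z <= K * lambda f z.

Definition univalent_on (U : C -> Prop) (f : C -> C) : Prop :=
  forall z1 z2 : C, U z1 -> U z2 -> f z1 = f z2 -> z1 = z2.

(* For an open set, connectedness may be tested on open subsets of it. *)
Definition domain (Omega : C -> Prop) : Prop :=
  (exists z : C, Omega z) /\ open Omega /\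
  forall U V : C -> Prop, open U -> open V ->
    (forall z : C, Omega z <-> U z \/ V z) ->
    (exists z : C, U z) -> (exists z : C, V z) ->
    exists z : C, U z /\ V z.

(* f(D_r) contains the schlicht disk D_rho(a). *)
Definition contains_schlicht_disk (f : C -> C) (r : R) (a : C) (rho : R)
    : Prop :=
  exists Omega : C -> Prop,
    domain Omega /\
    (forall z : C, Omega z -> unit_disk z /\ disk 0 r z) /\
    univalent_on Omega f /\
    (forall w : C, disk a rho w <-> exists z : C, Omega z /\ f z = w).

(* Main.v *)
Require Import Defs.
From Stdlib Require Import Reals Lra Psatz ClassicalEpsilon FunctionalExtensionality.
From Coquelicot Require Import Coquelicot.
Local Open Scope R_scope.

(** On [|z| < 1/sqrt 3] the Cauchy estimate, transported by a disk automorphism,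
    gives [|h'| <= M / (1 - |z|^2) < 3M/2], hence by quasiregularity
    [|h'| + |g'| < L := 3KM/(K+1)]. For a unit direction [u] choose a unit [v]
    aligned with the derivative of [f] at [0] in direction [u]: then
    [Re (v * d/dt f(z + t u)) = Re q(z)] for the holomorphic function
    [q = v u h' + conj v u g'], which satisfies [|q| < L] and [Re q(0) >= 1].
    Integrating the infinitesimal Schwarz-Pick inequality along rays yields
    [Re q(z) >= L (1 - L rho) / (L - rho)] with [rho = sqrt 3 |z|], which is
    positive exactly for [|z| < r2]. Integrating this bound along segments gives
    univalence, and along radii [|f(z)| >= P(|z|)] with [P(r2) = r3]. Each point of
    the disk of radius [r3] is then reached from [0] by small steps along a ray: a
    nearby value is attained where the distance to it is minimal, because the
    differential of [f] is onto.

    Holomorphy of [h'] and [g'] comes from the C2 assumption on [f], so only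
    holomorphic functions with a continuous derivative are integrated. *)

(** * Complex numbers *)

(** Origin of the constants. On |z| < sigma the same estimate bounds |h'| + |g'| by L(sigma) = 2KM /
    ((K+1)(1 - sigma^2)), and the resulting radius of univalence is sigma / L(sigma), proportional
    to sigma (1 - sigma^2); this is largest at sigma = 1/sqrt 3, whence the factor 3 sqrt 3 in r2.
    The lower bound on Re q is a Moebius function of the radius, so its primitive P contains a
    logarithm. The obstacle is the conjugate in f = h + conj g: a directional derivative of f is not
    holomorphic in the base point. After multiplication by a constant v its real part is the real
    part of a holomorphic q. Since v depends on the direction only, the bound may be integrated
    along a whole segment. The Cauchy estimate is obtained without contour integrals: the average
    A(r) of Re (psi(r e^(it)) e^(-it)) over a circle satisfies r A' = A, so A(r) / r is constant and
    links psi'(0) with the values of psi near the unit circle. *)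

Lemma C_ext (z w : C) : Re z = Re w -> Im z = Im w -> z = w.
Proof. destruct z, w; simpl; now intros -> ->. Qed.

Lemma C_eta (z : C) : (Re z, Im z) = z.
Proof. now destruct z. Qed.

Ltac C_algebra :=
  apply C_ext; unfold Re, Im; simpl; try ring; try field.

Lemma Cmod_minus_sym (z w : C) : Cmod (z - w) = Cmod (w - z).
Proof. rewrite <- Cmod_opp; f_equal; ring. Qed.

Lemma Cmod_minus_ge (z w : C) : Cmod z - Cmod w <= Cmod (z - w).
Proof.
  assert (H := Cmod_triangle (z - w) w).
  replace (z - w + w)%C with z in H by ring; lra.
Qed.

Lemma Cmod_minus_chasles (u v w : C) : Cmod (u - w) <= Cmod (u - v) + Cmod (v - w).
Proof. replace (u - w)%C with ((u - v) + (v - w))%C by ring; apply Cmod_triangle. Qed.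

Lemma im_le_Cmod (z : C) : Rabs (Im z) <= Cmod z.
Proof.
  rewrite <- (Rabs_Ropp (Im z)), <- re_mult_Ci.
  eapply Rle_trans; [apply re_le_Cmod|]; rewrite Cmod_mult, Cmod_Ci; lra.
Qed.

Lemma Re_le_Cmod (z : C) : Re z <= Cmod z.
Proof. eapply Rle_trans; [apply Rle_abs|apply re_le_Cmod]. Qed.

Lemma Cmod_le_abs (z : C) : Cmod z <= Rabs (Re z) + Rabs (Im z).
Proof.
  replace z with (RtoC (Re z) + Ci * RtoC (Im z))%C at 1 by C_algebra.
  eapply Rle_trans; [apply Cmod_triangle|].
  rewrite Cmod_mult, Cmod_Ci, !Cmod_R; lra.
Qed.

Lemma exists_unit_mult_real (z : C) : exists c : C, Cmod c = 1 /\ (c * z)%C = RtoC (Cmod z).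
Proof.
  destruct (Ceq_dec z 0) as [->|Hz].
  - exists (RtoC 1); rewrite Cmod_1, Cmod_0; split; [reflexivity|ring].
  - assert (H := proj1 (Cmod_gt_0 z) Hz).
    assert (Hm : RtoC (Cmod z) <> 0) by (intros E; apply RtoC_inj in E; lra).
    exists (Cconj z / RtoC (Cmod z))%C; split.
    + rewrite Cmod_div, Cmod_conj, Cmod_R, Rabs_pos_eq by (auto; lra); field; lra.
    + replace (Cconj z / Cmod z * z)%C with ((z * Cconj z) / Cmod z)%C
        by (unfold Cdiv; ring).
      rewrite <- Cmod2_conj, RtoC_pow; field; auto.
Qed.

Lemma exists_polar (z : C) : exists u : C, Cmod u = 1 /\ z = (Cmod z * u)%C.
Proof.
  destruct (exists_unit_mult_real z) as [c [Hc Ec]].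
  exists (Cconj c); split; [now rewrite Cmod_conj|].
  rewrite <- Ec; transitivity (z * (c * Cconj c))%C; [|ring].
  rewrite <- Cmod2_conj, Hc; C_algebra.
Qed.

(** * Continuity *)

(** Neighbourhoods in [C] come from the product structure, whose balls are squares; fitting a square
    into a disk costs the factor sqrt 2. *)
Lemma locally_C_Cmod (z : C) (P : C -> Prop) :
  locally z P <-> exists d, 0 < d /\ forall w, Cmod (w - z) < d -> P w.
Proof.
  split.
  - intros [d Hd]; exists d; split; [apply cond_pos|].
    intros w Hw; apply Hd, C_NormedModule_mixin_compat1, Hw.
  - intros [d [H0 Hd]].
    assert (Hs : 0 < sqrt 2) by (apply sqrt_lt_R0; lra).
    assert (He : 0 < d / sqrt 2) by (apply Rdiv_lt_0_compat; lra).
    exists (mkposreal _ He); intros w Hw; apply Hd.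
    apply (C_NormedModule_mixin_compat2 z w) in Hw; simpl in Hw.
    replace (sqrt 2 * (d / sqrt 2)) with d in Hw by (field; lra); exact Hw.
Qed.

Lemma locally_R_Rabs (x : R) (P : R -> Prop) :
  locally x P <-> exists d, 0 < d /\ forall y, Rabs (y - x) < d -> P y.
Proof.
  split.
  - intros [d Hd]; exists d; split; [apply cond_pos|]; exact Hd.
  - intros [d [H0 Hd]]; exists (mkposreal d H0); exact Hd.
Qed.

Lemma open_disk (a : C) (r : R) : open (disk a r).
Proof.
  intros z Hz; unfold disk in Hz; apply locally_C_Cmod.
  exists (r - Cmod (z - a)); split; [lra|intros w Hw; unfold disk].
  assert (H := Cmod_minus_chasles w z a); lra.
Qed.

Section ContinuousC.

Context {T : UniformSpace}.
Implicit Types (f g : T -> C) (x : T).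

Lemma continuous_C_eps f x :
  continuous f x <-> forall eps, 0 < eps -> locally x (fun y => Cmod (f y - f x) < eps).
Proof.
  split.
  - intros Hf eps He; apply (Hf (fun w => Cmod (w - f x) < eps)), locally_C_Cmod; eauto.
  - intros H P HP; apply locally_C_Cmod in HP; destruct HP as [d [Hd HP]].
    unfold filtermap; generalize (H d Hd); apply filter_imp; auto.
Qed.

Lemma continuous_Cplus f g x :
  continuous f x -> continuous g x -> continuous (fun y => f y + g y)%C x.
Proof.
  rewrite !continuous_C_eps; intros Hf Hg eps He.
  assert (He2 : 0 < eps / 2) by lra.
  generalize (filter_and _ _ (Hf _ He2) (Hg _ He2)).
  apply filter_imp; intros y [H1 H2].
  replace (f y + g y - (f x + g x))%C with ((f y - f x) + (g y - g x))%C by ring.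
  eapply Rle_lt_trans; [apply Cmod_triangle|lra].
Qed.

Lemma continuous_Cmult f g x :
  continuous f x -> continuous g x -> continuous (fun y => f y * g y)%C x.
Proof.
  rewrite !continuous_C_eps; intros Hf Hg eps He.
  set (B := Cmod (f x) + Cmod (g x) + 1).
  assert (HB : 1 <= B).
  { unfold B; assert (H1 := Cmod_ge_0 (f x)); assert (H2 := Cmod_ge_0 (g x)); lra. }
  (* The bound 1 keeps |f y| below |f x| + 1; the product then varies by at most e * B <= eps /
     2. *)
  set (e := Rmin 1 (eps / (2 * B))).
  assert (Hq : 0 < eps / (2 * B)) by (apply Rdiv_lt_0_compat; lra).
  assert (H0 : 0 < e) by (apply Rmin_glb_lt; lra).
  generalize (filter_and _ _ (Hf e H0) (Hg e H0)).
  apply filter_imp; intros y [H1 H2].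
  replace (f y * g y - f x * g x)%C
    with ((f y - f x) * g x + (f y - f x + f x) * (g y - g x))%C by ring.
  eapply Rle_lt_trans; [apply Cmod_triangle|]; rewrite !Cmod_mult.
  assert (H3 := Cmod_triangle (f y - f x) (f x)).
  assert (e <= 1) by apply Rmin_l.
  assert (H4 : e <= eps / (2 * B)) by apply Rmin_r.
  assert (H5 : e * B <= eps / 2).
  { replace (eps / 2) with (eps / (2 * B) * B) by (field; lra).
    apply Rmult_le_compat_r; lra. }
  assert (H6 := Cmod_ge_0 (f y - f x)); assert (H7 := Cmod_ge_0 (g y - g x)).
  assert (H8 := Cmod_ge_0 (f x)); assert (H9 := Cmod_ge_0 (g x)).
  assert (Cmod (f y - f x) * Cmod (g x) <= e * Cmod (g x)) by nra.
  assert (Cmod (f y - f x + f x) * Cmod (g y - g x) < (1 + Cmod (f x)) * e).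
  { apply Rle_lt_trans with ((1 + Cmod (f x)) * Cmod (g y - g x)); nra. }
  unfold B in H5; lra.
Qed.

Lemma continuous_Cinv f x :
  continuous f x -> f x <> 0 -> continuous (fun y => / f y)%C x.
Proof.
  rewrite !continuous_C_eps; intros Hf Hx eps He.
  assert (Hm := proj1 (Cmod_gt_0 _) Hx); set (m := Cmod (f x)) in *.
  (* The first bound keeps |f y| above m / 2, so the denominator |f y| * m is at least m^2 / 2,
     which the second bound compensates. *)
  set (e := Rmin (m / 2) (eps * (m * m / 2))).
  assert (0 < m * m) by nra.
  assert (H0 : 0 < e) by (apply Rmin_glb_lt; nra).
  generalize (Hf e H0); apply filter_imp; intros y Hy.
  assert (e <= m / 2) by apply Rmin_l.
  assert (H4 : e <= eps * (m * m / 2)) by apply Rmin_r.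
  assert (H5 := Cmod_minus_ge (f x) (f y)); rewrite Cmod_minus_sym in H5; fold m in H5.
  assert (Hy0 : f y <> 0) by (apply Cmod_gt_0; lra).
  replace (/ f y - / f x)%C with ((f x - f y) * / (f y * f x))%C by (field; auto).
  rewrite Cmod_mult, Cmod_inv, Cmod_mult, Cmod_minus_sym by (now apply Cmult_neq_0).
  fold m; apply Rmult_lt_reg_r with (Cmod (f y) * m); [nra|].
  rewrite Rmult_assoc, Rinv_l, Rmult_1_r by nra.
  apply Rlt_le_trans with (1 := Hy), Rle_trans with (1 := H4).
  apply Rmult_le_compat_l; nra.
Qed.

Lemma continuous_Cconj f x : continuous f x -> continuous (fun y => Cconj (f y)) x.
Proof.
  rewrite !continuous_C_eps; intros Hf eps He; generalize (Hf eps He).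
  apply filter_imp; intros y; rewrite <- Cminus_conj, Cmod_conj; auto.
Qed.

Lemma continuous_Re f x : continuous f x -> continuous (fun y => Re (f y)) x.
Proof. intros Hf; apply (continuous_comp f fst); [exact Hf|apply continuous_fst]. Qed.

Lemma continuous_Im f x : continuous f x -> continuous (fun y => Im (f y)) x.
Proof. intros Hf; apply (continuous_comp f snd); [exact Hf|apply continuous_snd]. Qed.

Lemma continuous_C_pair (a b : T -> R) x :
  continuous a x -> continuous b x -> continuous (fun y => (a y, b y) : C) x.
Proof.
  intros Ha Hb; apply continuous_C_eps; intros eps He.
  assert (H2 : 0 < eps / 2) by lra.
  assert (Ha' := Ha _ (locally_ball (a x) (mkposreal _ H2))).
  assert (Hb' := Hb _ (locally_ball (b x) (mkposreal _ H2))).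
  unfold filtermap in Ha', Hb'.
  generalize (filter_and _ _ Ha' Hb'); apply filter_imp; intros y [H3 H4].
  eapply Rle_lt_trans; [apply Cmod_le_abs|]; simpl.
  change (Rabs (a y - a x) < eps / 2) in H3; change (Rabs (b y - b x) < eps / 2) in H4.
  unfold Rminus in *; lra.
Qed.

(** * Derivatives in Caratheodory form *)

(* Complex differentiability is the case [i = id] and differentiability of a
   path [R -> C] the case [i = RtoC]; both calculi are proved at once. *)
Definition cdiff (i : T -> C) (f : T -> C) (x : T) (l : C) : Prop :=
  exists phi : T -> C, continuous phi x /\ phi x = l /\
    forall y, (f y - f x)%C = (phi y * (i y - i x))%C.

Variable i : T -> C.

Lemma cdiff_const (c : C) x : cdiff i (fun _ => c) x 0.
Proof.
  exists (fun _ => RtoC 0); repeat split; [apply continuous_const|intros; ring].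
Qed.

Lemma cdiff_plus f g x l k :
  cdiff i f x l -> cdiff i g x k -> cdiff i (fun y => f y + g y)%C x (l + k)%C.
Proof.
  intros [p [Hp [<- Ep]]] [q [Hq [<- Eq]]].
  exists (fun y => p y + q y)%C; split; [now apply continuous_Cplus|split; [reflexivity|]].
  intros y; replace (f y + g y - (f x + g x))%C with ((f y - f x) + (g y - g x))%C by ring.
  rewrite Ep, Eq; ring.
Qed.

Lemma cdiff_continuous f x l : continuous i x -> cdiff i f x l -> continuous f x.
Proof.
  intros Hi [p [Hp [_ Ep]]].
  assert (E : forall y, (f x + p y * (i y + - i x))%C = f y).
  { intros y; replace (f y) with (f y - f x + f x)%C by ring; rewrite Ep; ring. }
  apply (continuous_ext _ _ _ E).
  apply continuous_Cplus; [apply continuous_const|].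
  apply continuous_Cmult; [exact Hp|].
  apply continuous_Cplus; [exact Hi|apply continuous_const].
Qed.

Lemma cdiff_mult f g x l k :
  continuous i x -> cdiff i f x l -> cdiff i g x k ->
  cdiff i (fun y => f y * g y)%C x (l * g x + f x * k)%C.
Proof.
  intros Hi Hf Hg; assert (Cg := cdiff_continuous _ _ _ Hi Hg).
  destruct Hf as [p [Hp [<- Ep]]]; destruct Hg as [q [Hq [<- Eq]]].
  exists (fun y => p y * g y + f x * q y)%C; split; [|split; [reflexivity|]].
  - apply continuous_Cplus; apply continuous_Cmult; auto; apply continuous_const.
  - intros y; replace (f y * g y - f x * g x)%C
      with ((f y - f x) * g y + f x * (g y - g x))%C by ring.
    rewrite Ep, Eq; ring.
Qed.

Lemma cdiff_scal (c : C) f x l : cdiff i f x l -> cdiff i (fun y => c * f y)%C x (c * l)%C.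
Proof.
  intros [p [Hp [<- Ep]]]; exists (fun y => c * p y)%C; split; [|split; [reflexivity|]].
  - apply continuous_Cmult; [apply continuous_const|exact Hp].
  - intros y; replace (c * f y - c * f x)%C with (c * (f y - f x))%C by ring.
    rewrite Ep; ring.
Qed.

Lemma cdiff_ext f g x l : (forall y, f y = g y) -> cdiff i f x l -> cdiff i g x l.
Proof.
  intros E [p [Hp [El Ep]]]; exists p; repeat split; auto.
  intros y; rewrite <- !E; apply Ep.
Qed.

(** The factorisation in [cdiff] is required at every y, so functions that agree only near x need a
    new slope: the difference quotient of g, with value l at x. The injectivity of [i] at x permits
    the division. *)
Lemma cdiff_ext_loc f g x l :
  continuous i x -> (forall y, y <> x -> i y <> i x) ->
  locally x (fun y => f y = g y) -> cdiff i f x l -> cdiff i g x l.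
Proof.
  intros Hi Hinj E [p [Hp [El Ep]]].
  assert (Ex := locally_singleton _ _ E).
  exists (fun y => if excluded_middle_informative (y = x) then l
                   else (g y - g x) / (i y - i x))%C.
  split; [|split].
  - apply continuous_ext_loc with p; [|exact Hp].
    revert E; apply filter_imp; intros y Ey.
    destruct (excluded_middle_informative (y = x)) as [->|n]; [exact El|].
    rewrite <- Ey, <- Ex, Ep; change (@eq C (p y) (p y * (i y - i x) / (i y - i x))%C).
    field; apply Cminus_eq_contra, Hinj, n.
  - now destruct (excluded_middle_informative (x = x)).
  - intros y; destruct (excluded_middle_informative (y = x)) as [->|n].
    + replace (g x - g x)%C with (RtoC 0) by ring; ring.
    + field; apply Cminus_eq_contra, Hinj, n.
Qed.

End ContinuousC.

Lemma cdiff_comp {T : UniformSpace} (i : T -> C) (f : C -> C) (g : T -> C) (x : T) (l k : C) :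
  continuous i x -> cdiff (fun z => z) f (g x) l -> cdiff i g x k ->
  cdiff i (fun y => f (g y)) x (l * k)%C.
Proof.
  intros Hi Hf Hg; assert (Cg := cdiff_continuous _ _ _ _ Hi Hg).
  destruct Hf as [p [Hp [<- Ep]]]; destruct Hg as [q [Hq [<- Eq]]].
  exists (fun y => p (g y) * q y)%C; split; [|split; [reflexivity|]].
  - apply continuous_Cmult; [|exact Hq].
    now apply (continuous_comp g p).
  - intros y; rewrite Ep, Eq; ring.
Qed.

Local Notation cder := (cdiff (fun z : C => z)).
Local Notation pder := (cdiff RtoC).

Lemma continuous_RtoC (t : R) : continuous RtoC t.
Proof. apply continuous_C_pair; [apply continuous_id|apply continuous_const]. Qed.

Lemma cder_inv (z : C) : z <> 0 -> cder Cinv z (- (/ (z * z)))%C.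
Proof.
  intros Hz.
  (* Here [/ 0] is 0, so at w = 0 the required identity reads -1/z = phi(0) (0 - z), which forces
     the value 1/z^2. *)
  exists (fun w => if Ceq_dec w 0 then (/ z / z)%C else - (/ (w * z)))%C.
  split; [|split].
  - apply continuous_ext_loc with (fun w => (- (1)) * / (w * z))%C.
    + apply locally_C_Cmod; exists (Cmod z); split; [now apply Cmod_gt_0|].
      intros w Hw; destruct (Ceq_dec w 0) as [->|n];
        [|change (@eq C ((- (1)) * / (w * z))%C (- / (w * z))%C); ring].
      exfalso; rewrite Cmod_minus_sym in Hw; replace (z - 0)%C with z in Hw by ring; lra.
    + apply continuous_Cmult; [apply continuous_const|].
      apply continuous_Cinv; [|now apply Cmult_neq_0].
      apply continuous_Cmult; [apply continuous_id|apply continuous_const].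
  - now destruct (Ceq_dec z 0).
  - intros w; destruct (Ceq_dec w 0) as [->|n]; [|field; auto].
    replace (/ 0)%C with (RtoC 0) by (apply C_ext; simpl; unfold Rdiv; ring).
    field; auto.
Qed.

Lemma cder_of_little_o (h : C -> C) (z l : C) :
  (forall eps, 0 < eps ->
     locally z (fun w => Cmod (h w - h z - (w - z) * l) <= eps * Cmod (w - z))) ->
  cder h z l.
Proof.
  intros H.
  exists (fun w => if Ceq_dec w z then l else (h w - h z) / (w - z))%C.
  split; [|split].
  - apply continuous_C_eps; intros eps He.
    assert (He2 : 0 < eps / 2) by lra.
    generalize (H _ He2); apply filter_imp; intros w Hw.
    destruct (Ceq_dec z z) as [_|n]; [|now elim n].
    destruct (Ceq_dec w z) as [_|n].
    { replace (l - l)%C with (RtoC 0) by ring; rewrite Cmod_0; exact He. }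
    assert (n' := Cminus_eq_contra _ _ n); assert (Hp := proj1 (Cmod_gt_0 _) n').
    replace ((h w - h z) / (w - z) - l)%C
      with (((h w - h z) - (w - z) * l) / (w - z))%C by (field; exact n').
    rewrite Cmod_div by exact n'.
    apply Rmult_lt_reg_r with (Cmod (w - z)); [exact Hp|].
    unfold Rdiv; rewrite Rmult_assoc, Rinv_l, Rmult_1_r by lra.
    apply Rle_lt_trans with (eps / 2 * Cmod (w - z)); [exact Hw|].
    apply Rmult_lt_compat_r; lra.
  - now destruct (Ceq_dec z z).
  - intros w; destruct (Ceq_dec w z) as [->|n]; [ring|].
    field; now apply Cminus_eq_contra.
Qed.

(** * Passage between slopes and [is_derive] *)

Lemma cder_of_is_derive (h : C -> C) (z l : C) :
  @is_derive C_AbsRing C_NormedModule h z l -> cder h z l.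
Proof.
  intros [_ H]; specialize (H z (fun P HP => HP)).
  apply cder_of_little_o; intros eps He.
  apply locally_C, (H (mkposreal _ He)).
Qed.

Lemma is_derive_caratheodory (f phi : R -> R) (t : R) :
  (forall s, f s - f t = phi s * (s - t)) -> continuous phi t -> is_derive f t (phi t).
Proof.
  intros E Hc; apply is_derive_Reals; intros eps He.
  assert (H := Hc _ (locally_ball (phi t) (mkposreal _ He))).
  apply locally_R_Rabs in H; destruct H as [d [Hd H]].
  exists (mkposreal d Hd); intros h Hh Hhd; simpl in Hhd.
  rewrite E; replace (phi (t + h) * (t + h - t) / h) with (phi (t + h)) by (field; auto).
  apply H; replace (t + h - t) with h by ring; exact Hhd.
Qed.

Lemma caratheodory_is_derive (f : R -> R) (t l : R) :
  is_derive f t l ->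
  exists phi : R -> R, continuous phi t /\ phi t = l /\
    forall s, f s - f t = phi s * (s - t).
Proof.
  intros H; apply is_derive_Reals in H.
  exists (fun s => if Req_EM_T s t then l else (f s - f t) / (s - t)).
  split; [|split].
  - intros P [eps HP]; destruct (H eps (cond_pos eps)) as [d Hd].
    exists d; intros s Hs; apply HP; change R in s.
    destruct (Req_EM_T t t) as [_|n]; [|now elim n].
    destruct (Req_EM_T s t) as [_|n]; [apply ball_center|].
    assert (n' : s - t <> 0) by lra.
    specialize (Hd (s - t) n' Hs); replace (t + (s - t)) with s in Hd by ring.
    exact Hd.
  - now destruct (Req_EM_T t t).
  - intros s; destruct (Req_EM_T s t) as [->|n]; [ring|field; lra].
Qed.

Lemma pder_Re (c : R -> C) (t : R) (v : C) :
  pder c t v -> is_derive (fun s => Re (c s)) t (Re v).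
Proof.
  intros [p [Hp [<- E]]].
  apply (is_derive_caratheodory _ (fun s => Re (p s))); [|now apply continuous_Re].
  intros s; transitivity (Re (c s - c t)); [unfold Re, Im; simpl; ring|].
  rewrite E; unfold Re, Im; simpl; ring.
Qed.

Lemma pder_Im (c : R -> C) (t : R) (v : C) :
  pder c t v -> is_derive (fun s => Im (c s)) t (Im v).
Proof.
  intros [p [Hp [<- E]]].
  apply (is_derive_caratheodory _ (fun s => Im (p s))); [|now apply continuous_Im].
  intros s; transitivity (Im (c s - c t)); [unfold Re, Im; simpl; ring|].
  rewrite E; unfold Re, Im; simpl; ring.
Qed.

Lemma pder_pair (a b : R -> R) (t l k : R) :
  is_derive a t l -> is_derive b t k -> pder (fun s => (a s, b s)) t (l, k).
Proof.
  intros Ha Hb.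
  destruct (caratheodory_is_derive _ _ _ Ha) as [p [Hp [<- Ep]]].
  destruct (caratheodory_is_derive _ _ _ Hb) as [q [Hq [<- Eq]]].
  exists (fun s => (p s, q s)); split; [now apply continuous_C_pair|split; [reflexivity|]].
  intros s; specialize (Ep s); specialize (Eq s); apply C_ext; simpl; lra.
Qed.

Lemma pder_conj (c : R -> C) (t : R) (v : C) :
  pder c t v -> pder (fun s => Cconj (c s)) t (Cconj v).
Proof.
  intros [p [Hp [<- E]]]; exists (fun s => Cconj (p s)).
  split; [now apply continuous_Cconj|split; [reflexivity|]].
  intros s; rewrite <- Cminus_conj, E, Cmult_conj; f_equal; C_algebra.
Qed.

Lemma pder_line (z u : C) (t : R) : pder (fun s => z + s * u)%C t u.
Proof.
  exists (fun _ => u); split; [apply continuous_const|split; [reflexivity|]].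
  intros; ring.
Qed.

Lemma cder_continuous (f : C -> C) (z l : C) : cder f z l -> continuous f z.
Proof. apply cdiff_continuous, continuous_id. Qed.

Lemma pder_comp (f : C -> C) (c : R -> C) (t : R) (l v : C) :
  cder f (c t) l -> pder c t v -> pder (fun s : R => f (c s)) t (l * v)%C.
Proof. apply cdiff_comp, continuous_RtoC. Qed.

Lemma cder_comp (f g : C -> C) (z l k : C) :
  cder f (g z) l -> cder g z k -> cder (fun w => f (g w)) z (l * k)%C.
Proof. apply cdiff_comp, continuous_id. Qed.

(** * The Cauchy estimate *)

Definition circ (t : R) : C := (cos t, sin t).

Lemma circ_conj (t : R) : (circ t * Cconj (circ t))%C = 1.
Proof.
  assert (H := sin2_cos2 t); unfold Rsqr in H.
  apply C_ext; unfold Re, Im; simpl; [lra|ring].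
Qed.

Lemma Cmod_circ (t : R) : Cmod (circ t) = 1.
Proof.
  assert (H := Cmod2_conj (circ t)); rewrite circ_conj in H; apply RtoC_inj in H.
  assert (H0 := Cmod_ge_0 (circ t)); nra.
Qed.

Lemma pder_circ (t : R) : pder circ t (Ci * circ t)%C.
Proof.
  replace (Ci * circ t)%C with ((- sin t, cos t) : C) by C_algebra.
  apply pder_pair; auto_derive; auto; ring.
Qed.

Lemma continuous_circ (t : R) : continuous circ t.
Proof. eapply cdiff_continuous; [apply continuous_RtoC|apply pder_circ]. Qed.

(** * Averages of a holomorphic function over circles *)

Section CircleAverage.

Variables psi dpsi : C -> C.
Hypothesis psi_der : forall z, Cmod z < 1 -> cder psi z (dpsi z).
Hypothesis dpsi_cont : forall z, Cmod z < 1 -> continuous dpsi z.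

(** Integrand of the first Fourier coefficient of [psi] on the circle of radius r; its integral over
    a period is to be 2 pi r psi'(0). *)
Let val (r t : R) : C := (psi (r * circ t) * Cconj (circ t))%C.

Lemma Cmod_scal_circ (r t : R) : Rabs r < 1 -> Cmod (r * circ t) < 1.
Proof. rewrite Cmod_mult, Cmod_R, Cmod_circ; lra. Qed.

Lemma circle_radial_der (r t : R) : Rabs r < 1 ->
  is_derive (fun s : R => Re (val s t)) r (Re (dpsi (r * circ t))).
Proof.
  intros Hr; replace (dpsi (r * circ t))
    with (Cconj (circ t) * (dpsi (r * circ t) * circ t))%C.
  2:{ transitivity (dpsi (r * circ t) * (circ t * Cconj (circ t)))%C; [ring|].
      rewrite circ_conj; ring. }
  apply pder_Re.
  apply cdiff_ext with (fun s : R => Cconj (circ t) * psi (s * circ t))%C;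
    [intros; unfold val; ring|].
  apply cdiff_scal, (pder_comp psi (fun s : R => (s * circ t)%C)).
  - now apply psi_der, Cmod_scal_circ.
  - apply cdiff_ext with (fun s : R => 0 + s * circ t)%C; [intros; ring|apply pder_line].
Qed.

(** The t-derivative of [val] is [Ci] times r psi' - val, so the imaginary part of [val] is a
    primitive of a combination of the two real integrands to be compared. *)
Lemma circle_angular_der (r t : R) : Rabs r < 1 ->
  is_derive (fun s : R => Im (val r s)) t (r * Re (dpsi (r * circ t)) - Re (val r t)).
Proof.
  intros Hr.
  replace (r * Re (dpsi (r * circ t)) - Re (val r t))
    with (Im ((dpsi (r * circ t) * (r * (Ci * circ t))) * Cconj (circ t)
              + psi (r * circ t) * Cconj (Ci * circ t))%C).
  - apply pder_Im.
    apply (cdiff_mult RtoC (fun s : R => psi (r * circ s)) (fun s : R => Cconj (circ s)) t).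
    + apply continuous_RtoC.
    + apply (pder_comp psi (fun s : R => (r * circ s)%C)).
      * now apply psi_der, Cmod_scal_circ.
      * apply cdiff_scal, pder_circ.
    + apply pder_conj, pder_circ.
  - transitivity (Im (Ci * (r * dpsi (r * circ t) * (circ t * Cconj (circ t))
                            - val r t))%C).
    + f_equal; unfold val; rewrite Cmult_conj.
      replace (Cconj Ci) with (- Ci)%C by C_algebra; ring.
    + rewrite circ_conj; unfold Re, Im; simpl; ring.
Qed.

Lemma circle_continuous (r t : R) : Rabs r < 1 -> continuous (fun s : R => Re (val r s)) t.
Proof.
  intros Hr; apply (continuous_Re (val r)); apply continuous_Cmult.
  - apply (continuous_comp (fun s : R => (r * circ s)%C) psi).
    + apply continuous_Cmult; [apply continuous_const|apply continuous_circ].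
    + now eapply cder_continuous, psi_der, Cmod_scal_circ.
  - apply continuous_Cconj, continuous_circ.
Qed.

Lemma circle_dpsi_continuity_2d (r t : R) : Rabs r < 1 ->
  continuity_2d_pt (fun u v => Re (dpsi (u * circ v))) r t.
Proof.
  intros Hr; apply continuity_2d_pt_filterlim.
  apply (continuous_Re (fun p : R * R => dpsi (fst p * circ (snd p))%C) (r, t)).
  apply (continuous_comp (fun p : R * R => (fst p * circ (snd p))%C) dpsi).
  - apply continuous_Cmult.
    + apply (continuous_comp fst RtoC); [apply continuous_fst|apply continuous_RtoC].
    + apply (continuous_comp snd circ); [apply continuous_snd|apply continuous_circ].
  - now apply dpsi_cont, Cmod_scal_circ.
Qed.

Lemma circle_dpsi_continuous (r t : R) : Rabs r < 1 ->
  continuous (fun s : R => Re (dpsi (r * circ s))) t.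
Proof.
  intros Hr; apply (continuous_Re (fun s : R => dpsi (r * circ s)%C)).
  apply (continuous_comp (fun s : R => (r * circ s)%C) dpsi).
  - apply continuous_Cmult; [apply continuous_const|apply continuous_circ].
  - now apply dpsi_cont, Cmod_scal_circ.
Qed.

Lemma circle_ex_RInt (r : R) : Rabs r < 1 -> ex_RInt (fun t => Re (val r t)) 0 (2 * PI).
Proof.
  intros Hr; apply (ex_RInt_continuous (V := R_CompleteNormedModule)).
  intros; now apply circle_continuous.
Qed.

Lemma circle_dpsi_ex_RInt (r : R) : Rabs r < 1 ->
  ex_RInt (fun t => Re (dpsi (r * circ t))) 0 (2 * PI).
Proof.
  intros Hr; apply (ex_RInt_continuous (V := R_CompleteNormedModule)).
  intros; now apply circle_dpsi_continuous.
Qed.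

Let A (r : R) : R := RInt (fun t => Re (val r t)) 0 (2 * PI).
Let B (r : R) : R := RInt (fun t => Re (dpsi (r * circ t))) 0 (2 * PI).

Lemma locally_Rabs_lt (r : R) : Rabs r < 1 -> locally r (fun s : R => Rabs s < 1).
Proof.
  intros Hr; apply locally_R_Rabs; exists (1 - Rabs r); split; [lra|].
  intros s Hs; assert (H := Rabs_triang (s - r) r).
  replace (s - r + r) with s in H by ring; lra.
Qed.

Lemma circle_average_der (r : R) : Rabs r < 1 -> is_derive A r (B r).
Proof.
  intros Hr.
  replace (B r) with (RInt (fun t => Derive (fun u => Re (val u t)) r) 0 (2 * PI)).
  2:{ apply RInt_ext; intros t _; now apply is_derive_unique, circle_radial_der. }
  apply (is_derive_RInt_param (fun r t => Re (val r t))).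
  - generalize (locally_Rabs_lt r Hr); apply filter_imp; intros s Hs t _.
    eexists; now apply circle_radial_der.
  - intros t _; eapply continuity_2d_pt_ext_loc; [|now apply (circle_dpsi_continuity_2d r t)].
    destruct (locally_Rabs_lt r Hr) as [d Hd]; exists d; intros u v Hu _.
    symmetry; apply is_derive_unique, circle_radial_der, Hd, Hu.
  - generalize (locally_Rabs_lt r Hr); apply filter_imp; intros s Hs.
    now apply circle_ex_RInt.
Qed.

(** The angular derivative integrates to zero over a period. This relation takes the place of
    Cauchy's theorem. *)
Lemma circle_average_eq (r : R) : Rabs r < 1 -> r * B r = A r.
Proof.
  intros Hr.
  assert (H : is_RInt (fun t => r * Re (dpsi (r * circ t)) - Re (val r t)) 0 (2 * PI)
                (minus (Im (val r (2 * PI))) (Im (val r 0)))).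
  { apply (is_RInt_derive (V := R_CompleteNormedModule) (fun t => Im (val r t))).
    - intros t _; now apply circle_angular_der.
    - intros t _; apply (continuous_minus (V := R_NormedModule)).
      + apply (continuous_scal_r (V := R_NormedModule)); now apply circle_dpsi_continuous.
      + now apply circle_continuous. }
  replace (val r (2 * PI)) with (val r 0) in H.
  2:{ unfold val, circ; now rewrite cos_0, sin_0, cos_2PI, sin_2PI. }
  assert (H2 : is_RInt (fun t => r * Re (dpsi (r * circ t)) - Re (val r t)) 0 (2 * PI)
                (minus (scal r (B r)) (A r))).
  { apply (is_RInt_minus (V := R_NormedModule)).
    - apply (is_RInt_scal (V := R_NormedModule)).
      apply (RInt_correct (V := R_CompleteNormedModule)), circle_dpsi_ex_RInt, Hr.
    - apply (RInt_correct (V := R_CompleteNormedModule)), circle_ex_RInt, Hr. }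
  assert (E : minus (Im (val r 0)) (Im (val r 0)) = minus (scal r (B r)) (A r)).
  { rewrite <- (is_RInt_unique _ _ _ _ H); apply (is_RInt_unique _ _ _ _ H2). }
  unfold minus, plus, opp, scal in E; simpl in E; unfold mult in E; simpl in E; lra.
Qed.

Lemma circle_average_zero_der : B 0 = 2 * PI * Re (dpsi 0).
Proof.
  unfold B; transitivity (RInt (fun _ => Re (dpsi 0)) 0 (2 * PI)).
  - apply RInt_ext; intros t _; now replace (0 * circ t)%C with (RtoC 0) by ring.
  - rewrite RInt_const; unfold scal; simpl; unfold mult; simpl; ring.
Qed.

(** Since A' = B and r B = A, the derivative of A(r) / r vanishes. *)
Lemma circle_average_ratio (r s : R) : 0 < r < 1 -> 0 < s < 1 -> A r / r = A s / s.
Proof.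
  intros Hr Hs.
  destruct (MVT_gen (fun x => A x / x) r s (fun _ => 0)) as [c [_ E]].
  - intros x Hx; assert (Hx' : 0 < x < 1).
    { split; [apply Rlt_le_trans with (Rmin r s); [apply Rmin_glb_lt; lra|lra]|].
      apply Rlt_le_trans with (Rmax r s); [lra|apply Rmax_lub; lra]. }
    assert (Hax : Rabs x < 1) by (rewrite Rabs_pos_eq; lra).
    replace 0 with ((B x * x - A x * 1) / x ^ 2).
    2:{ rewrite <- (circle_average_eq x Hax); field; lra. }
    apply (is_derive_div A (fun y => y) x (B x) 1); [now apply circle_average_der|apply (is_derive_id (K := R_AbsRing))|lra].
  - intros x Hx; assert (Hx' : 0 < x < 1).
    { split; [apply Rlt_le_trans with (Rmin r s); [apply Rmin_glb_lt; lra|lra]|].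
      apply Rle_lt_trans with (Rmax r s); [lra|apply Rmax_lub_lt; lra]. }
    assert (Hax : Rabs x < 1) by (rewrite Rabs_pos_eq; lra).
    apply continuity_pt_filterlim, (ex_derive_continuous (fun x => A x / x)).
    eexists; apply (is_derive_div A (fun y => y) x (B x) 1);
      [now apply circle_average_der|apply (is_derive_id (K := R_AbsRing))|lra].
  - lra.
Qed.

(** The constant A(r) / r tends to 2 pi Re psi'(0) as r tends to 0 and is at most 2 pi M / r for
    every r < 1. *)
Lemma Re_dpsi_0_le (M : R) :
  (forall z, Cmod z < 1 -> Cmod (psi z) <= M) -> Re (dpsi 0) <= M.
Proof.
  intros HM.
  assert (HA : forall r, 0 < r < 1 -> A r <= 2 * PI * M).
  { intros r Hr; assert (Hax : Rabs r < 1) by (rewrite Rabs_pos_eq; lra).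
    replace (2 * PI * M) with (RInt (fun _ => M) 0 (2 * PI))
      by (rewrite RInt_const; unfold scal; simpl; unfold mult; simpl; ring).
    assert (HP := PI_RGT_0).
    apply RInt_le; [lra|now apply circle_ex_RInt|apply ex_RInt_const|].
    intros t _; eapply Rle_trans; [apply Re_le_Cmod|].
    unfold val; rewrite Cmod_mult, Cmod_conj, Cmod_circ, Rmult_1_r.
    now apply HM, Cmod_scal_circ. }
  assert (HP := PI_RGT_0).
  apply Rnot_lt_le; intros Hlt.
  assert (H0 : Rabs 0 < 1) by (rewrite Rabs_R0; lra).
  assert (HM0 : 0 <= M).
  { eapply Rle_trans; [apply (Cmod_ge_0 (psi 0))|apply HM; rewrite Cmod_0; lra]. }
  set (m := Re (dpsi 0)) in *.
  assert (D := circle_average_der 0 H0); apply is_derive_Reals in D.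
  assert (He : 0 < PI * (m - M)) by nra.
  destruct (D _ He) as [d Hd].
  set (h := Rmin (d / 2) (1 / 2)).
  assert (Hd0 := cond_pos d).
  assert (Hh : 0 < h <= 1 / 2) by (split; [apply Rmin_glb_lt; lra|apply Rmin_r]).
  assert (Hh2 : h <= d / 2) by apply Rmin_l.
  assert (E0 : A 0 = 0) by (rewrite <- (circle_average_eq 0 H0); ring).
  specialize (Hd h).
  rewrite Rplus_0_l, E0, Rminus_0_r, circle_average_zero_der in Hd; fold m in Hd.
  assert (Hd' : Rabs (A h / h - 2 * PI * m) < PI * (m - M)).
  { apply Hd; [lra|rewrite Rabs_pos_eq; lra]. }
  apply Rabs_def2 in Hd'.
  (* Chosen so that (m + M) s = (m + 3 M) / 2, which exceeds 2 M because m > M, while s stays below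
     1. *)
  set (s := (m + 3 * M) / (2 * m + 2 * M)).
  assert (Hm : 0 < m) by lra.
  assert (Hs : 0 < s < 1).
  { unfold s; split; [apply Rdiv_lt_0_compat; lra|].
    apply Rmult_lt_reg_r with (2 * m + 2 * M); [lra|].
    unfold Rdiv; rewrite Rmult_assoc, Rinv_l; lra. }
  assert (Eh := circle_average_ratio h s ltac:(lra) Hs).
  assert (HAs := HA s Hs).
  assert (H1 : A h / h * s <= 2 * PI * M).
  { rewrite Eh; replace (A s / s * s) with (A s) by (field; lra); exact HAs. }
  assert (H2 : PI * (m + M) < A h / h) by lra.
  assert (H3 : PI * (m + M) * s < 2 * PI * M) by nra.
  replace (PI * (m + M) * s) with (PI * ((m + 3 * M) / 2)) in H3 by (unfold s; field; lra).
  nra.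
Qed.

End CircleAverage.

Lemma cauchy_estimate_0 (psi dpsi : C -> C) (M : R) :
  (forall z, Cmod z < 1 -> cder psi z (dpsi z)) ->
  (forall z, Cmod z < 1 -> continuous dpsi z) ->
  (forall z, Cmod z < 1 -> Cmod (psi z) <= M) ->
  Cmod (dpsi 0) <= M.
Proof.
  intros Hd Hc HM.
  destruct (exists_unit_mult_real (dpsi 0)) as [c [Hc1 E]].
  replace (Cmod (dpsi 0)) with (Re (c * dpsi 0)) by (rewrite E; reflexivity).
  apply (Re_dpsi_0_le (fun z => c * psi z)%C (fun z => c * dpsi z)%C).
  - intros z Hz; apply cdiff_scal, Hd, Hz.
  - intros z Hz; apply continuous_Cmult; [apply continuous_const|auto].
  - intros z Hz; rewrite Cmod_mult, Hc1, Rmult_1_l; auto.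
Qed.

(** * The Schwarz-Pick lemma *)

Lemma continuous_affine (a b z : C) : continuous (fun w : C => a * w + b)%C z.
Proof.
  apply continuous_Cplus; [|apply continuous_const].
  apply continuous_Cmult; [apply continuous_const|apply continuous_id].
Qed.

Lemma cder_affine (a b z : C) : cder (fun w => a * w + b)%C z a.
Proof.
  exists (fun _ => a); split; [apply continuous_const|split; [reflexivity|intros; ring]].
Qed.

Lemma cder_mobius (a b c d z : C) : (c * z + d)%C <> 0 ->
  cder (fun w => (a * w + b) / (c * w + d))%C z
       ((a * d - b * c) / ((c * z + d) * (c * z + d)))%C.
Proof.
  intros Hz.
  replace ((a * d - b * c) / ((c * z + d) * (c * z + d)))%C
    with (a * / (c * z + d) + (a * z + b) * (- (/ ((c * z + d) * (c * z + d))) * c))%C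
    by (field; exact Hz).
  apply (cdiff_mult (fun w => w) (fun w => a * w + b)%C (fun w => / (c * w + d))%C).
  - apply continuous_id.
  - apply cder_affine.
  - apply (cder_comp Cinv (fun w => c * w + d)%C); [now apply cder_inv|apply cder_affine].
Qed.

Lemma continuous_mobius_der (k c d z : C) : (c * z + d)%C <> 0 ->
  continuous (fun w : C => k / ((c * w + d) * (c * w + d)))%C z.
Proof.
  intros Hz; apply continuous_Cmult; [apply continuous_const|].
  apply continuous_Cinv; [|now apply Cmult_neq_0].
  apply continuous_Cmult; apply continuous_affine.
Qed.

(** Identity behind the invariance of the pseudo-hyperbolic distance on the disk of radius L. It is
    used with L = 1 for the automorphism of the domain and with general L for the target. *)
Lemma Cmod_pseudo_hyperbolic (L : R) (p q : C) :
  Cmod (L ^ 2 - Cconj p * q) ^ 2 - L ^ 2 * Cmod (q - p) ^ 2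
  = (L ^ 2 - Cmod p ^ 2) * (L ^ 2 - Cmod q ^ 2).
Proof. rewrite !Cmod2_alt; unfold Re, Im; simpl; ring. Qed.

Lemma Cmod_pseudo_hyperbolic_lt (L : R) (p q : C) : Cmod p < L -> Cmod q < L ->
  L * Cmod (q - p) < Cmod (L ^ 2 - Cconj p * q).
Proof.
  intros Hp Hq.
  assert (E := Cmod_pseudo_hyperbolic L p q).
  assert (H1 := Cmod_ge_0 p); assert (H2 := Cmod_ge_0 q).
  assert (H3 := Cmod_ge_0 (q - p)); assert (H4 := Cmod_ge_0 (L ^ 2 - Cconj p * q)).
  assert (0 < (L ^ 2 - Cmod p ^ 2) * (L ^ 2 - Cmod q ^ 2))
    by (apply Rmult_lt_0_compat; nra).
  assert (H5 : 0 <= L * Cmod (q - p)) by (apply Rmult_le_pos; lra).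
  apply Rnot_le_lt; intros Hle.
  assert (H6 := Rmult_le_compat _ _ _ _ H4 H4 Hle Hle); nra.
Qed.

Lemma cauchy_estimate (phi dphi : C -> C) (M : R) (a : C) :
  (forall z, Cmod z < 1 -> cder phi z (dphi z)) ->
  (forall z, Cmod z < 1 -> continuous dphi z) ->
  (forall z, Cmod z < 1 -> Cmod (phi z) <= M) ->
  Cmod a < 1 -> Cmod (dphi a) * (1 - Cmod a ^ 2) <= M.
Proof.
  intros Hd Hc HM Ha.
  (* T preserves the unit disk, T(0) = a and T'(0) = 1 - |a|^2, so the estimate at 0 for phi o T is
     the estimate at a for phi. *)
  set (T := fun w : C => ((1 * w + a) / (Cconj a * w + 1))%C).
  set (dT := fun w : C =>
    ((1 * 1 - a * Cconj a) / ((Cconj a * w + 1) * (Cconj a * w + 1)))%C).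
  assert (HT : forall w, Cmod w < 1 -> (Cconj a * w + 1)%C <> 0 /\ Cmod (T w) < 1).
  { intros w Hw.
    assert (H := Cmod_pseudo_hyperbolic_lt 1 (- a)%C w).
    rewrite Cmod_opp in H; specialize (H Ha Hw).
    replace (1 ^ 2 - Cconj (- a) * w)%C with (Cconj a * w + 1)%C in H by C_algebra.
    replace (w - - a)%C with (1 * w + a)%C in H by ring.
    assert (H0 := Cmod_ge_0 (1 * w + a)).
    assert (Hn : (Cconj a * w + 1)%C <> 0) by (apply Cmod_gt_0; lra).
    split; [exact Hn|]; unfold T; rewrite Cmod_div by exact Hn.
    apply Rmult_lt_reg_r with (Cmod (Cconj a * w + 1)); [lra|].
    unfold Rdiv; rewrite Rmult_assoc, Rinv_l; lra. }
  assert (HdT : forall w, Cmod w < 1 -> cder T w (dT w)).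
  { intros w Hw; apply cder_mobius, HT, Hw. }
  assert (H := cauchy_estimate_0 (fun w => phi (T w)) (fun w => dphi (T w) * dT w)%C M).
  cbv beta in H.
  assert (ET : T 0 = a) by (unfold T; field; apply C1_nz).
  assert (EdT : dT 0 = RtoC (1 - Cmod a ^ 2)).
  { rewrite RtoC_minus, RtoC_pow, <- RtoC_pow, Cmod2_conj; unfold dT; field; apply C1_nz. }
  rewrite ET, EdT, Cmod_mult, Cmod_R, Rabs_pos_eq in H
    by (assert (H1 := Cmod_ge_0 a); nra).
  apply H.
  - intros w Hw; apply cder_comp; [apply Hd, HT, Hw|now apply HdT].
  - intros w Hw; apply continuous_Cmult.
    + apply (continuous_comp T dphi); [eapply cder_continuous; now apply HdT|].
      apply Hc, HT, Hw.
    + apply continuous_mobius_der, HT, Hw.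
  - intros w Hw; apply HM, HT, Hw.
Qed.

Lemma schwarz_pick (q dq : C -> C) (L : R) (a : C) :
  (forall z, Cmod z < 1 -> cder q z (dq z)) ->
  (forall z, Cmod z < 1 -> continuous dq z) ->
  (forall z, Cmod z < 1 -> Cmod (q z) < L) ->
  Cmod a < 1 -> Cmod (dq a) * (L * (1 - Cmod a ^ 2)) <= L ^ 2 - Cmod (q a) ^ 2.
Proof.
  intros Hd Hc HL Ha.
  set (p := q a).
  assert (Hp : Cmod p < L) by (apply HL, Ha).
  assert (Hp0 := Cmod_ge_0 p).
  (* S maps the disk of radius L into the disk of radius 1/L and S'(p) = 1 / (L^2 - |p|^2); the
     Cauchy estimate for S o q at a is then the claim. *)
  set (S := fun w : C => ((1 * w + - p) / (- Cconj p * w + L ^ 2))%C).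
  set (dS := fun w : C =>
    ((1 * L ^ 2 - - p * - Cconj p) / ((- Cconj p * w + L ^ 2) * (- Cconj p * w + L ^ 2)))%C).
  assert (HS : forall w, Cmod w < L ->
            (- Cconj p * w + L ^ 2)%C <> 0 /\ Cmod (S w) <= / L).
  { intros w Hw.
    assert (H := Cmod_pseudo_hyperbolic_lt L p w Hp Hw).
    replace (L ^ 2 - Cconj p * w)%C with (- Cconj p * w + L ^ 2)%C in H by ring.
    replace (w - p)%C with (1 * w + - p)%C in H by ring.
    assert (H0 := Cmod_ge_0 (1 * w + - p)).
    assert (Hn : (- Cconj p * w + L ^ 2)%C <> 0) by (apply Cmod_gt_0; nra).
    split; [exact Hn|]; unfold S; rewrite Cmod_div by exact Hn.
    apply Rmult_le_reg_r with (Cmod (- Cconj p * w + L ^ 2)); [nra|].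
    unfold Rdiv; rewrite Rmult_assoc, Rinv_l by nra.
    apply Rmult_le_reg_l with L; [lra|].
    rewrite <- (Rmult_assoc L (/ L)), Rinv_r; lra. }
  assert (H := cauchy_estimate (fun w => S (q w)) (fun w => dS (q w) * dq w)%C (/ L) a).
  cbv beta in H; fold p in H.
  assert (HLp : 0 < L ^ 2 - Cmod p ^ 2) by nra.
  assert (EdS : dS p = RtoC (/ (L ^ 2 - Cmod p ^ 2))).
  { rewrite RtoC_inv, RtoC_minus, Cmod2_conj, RtoC_pow by lra; unfold dS.
    assert (n : (L ^ 2 - p * Cconj p)%C <> 0).
    { rewrite <- RtoC_pow, <- Cmod2_conj, <- RtoC_minus; intros E; apply RtoC_inj in E; lra. }
    field; intros E; apply n; rewrite <- E; ring. }
  rewrite EdS, Cmod_mult, Cmod_R, Rabs_pos_eq in H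
    by (apply Rlt_le, Rinv_0_lt_compat, HLp).
  assert (H1 : / (L ^ 2 - Cmod p ^ 2) * Cmod (dq a) * (1 - Cmod a ^ 2) <= / L).
  { apply H; auto.
    - intros w Hw; apply cder_comp; [|now apply Hd].
      apply cder_mobius, HS, HL, Hw.
    - intros w Hw; apply continuous_Cmult; [|now apply Hc].
      apply (continuous_comp q dS); [now eapply cder_continuous, Hd|].
      apply continuous_mobius_der, HS, HL, Hw.
    - intros w Hw; apply HS, HL, Hw. }
  apply Rmult_le_compat_l with (r := L * (L ^ 2 - Cmod p ^ 2)) in H1; [|nra].
  replace (L * (L ^ 2 - Cmod p ^ 2) * / L) with (L ^ 2 - Cmod p ^ 2) in H1 by (field; lra).
  eapply Rle_trans; [|exact H1]; right; field; lra.
Qed.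

Lemma derive_nonneg_le (f df : R -> R) (a b : R) : a <= b ->
  (forall t, a <= t <= b -> is_derive f t (df t)) ->
  (forall t, a <= t <= b -> 0 <= df t) -> f a <= f b.
Proof.
  intros Hab Hd Hp.
  destruct (MVT_gen f a b df) as [c [Hc E]].
  - rewrite Rmin_left, Rmax_right by lra; intros x Hx; apply Hd; lra.
  - rewrite Rmin_left, Rmax_right by lra; intros x Hx.
    apply continuity_pt_filterlim, (ex_derive_continuous f); eexists; now apply Hd.
  - rewrite Rmin_left, Rmax_right in Hc by lra; specialize (Hp c Hc); nra.
Qed.

(* The Schwarz-Pick bound says that artanh (Re q / L) + artanh t is nondecreasing
   along a ray; the logarithm below is twice that quantity. *)
Lemma Re_radial_lower_bound (q dq : C -> C) (L : R) (z : C) :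
  (forall z, Cmod z < 1 -> cder q z (dq z)) ->
  (forall z, Cmod z < 1 -> continuous dq z) ->
  (forall z, Cmod z < 1 -> Cmod (q z) < L) ->
  1 <= Re (q 0) -> Cmod z < 1 ->
  L * (1 - L * Cmod z) / (L - Cmod z) <= Re (q z).
Proof.
  intros Hd Hc HL H0 Hz.
  destruct (exists_polar z) as [u [Hu Ez]]; set (r := Cmod z) in *.
  assert (Hr := Cmod_ge_0 z); fold r in Hr.
  assert (Hu1 : forall t, 0 <= t <= r -> Cmod (t * u) = t).
  { intros t Ht; rewrite Cmod_mult, Cmod_R, Hu, Rabs_pos_eq; lra. }
  set (x := fun t : R => Re (q (t * u)%C)).
  set (x' := fun t : R => Re (dq (t * u)%C * u)).
  assert (Hx : forall t, 0 <= t <= r -> is_derive x t (x' t)).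
  { intros t Ht; apply pder_Re, (pder_comp q (fun t : R => (t * u)%C)).
    - apply Hd; rewrite Hu1; lra.
    - apply cdiff_ext with (fun s : R => 0 + s * u)%C; [intros; ring|apply pder_line]. }
  assert (HxL : forall t, 0 <= t <= r -> - L < x t < L).
  { intros t Ht; apply and_comm, Rabs_def2; eapply Rle_lt_trans; [apply re_le_Cmod|].
    apply HL; rewrite Hu1; lra. }
  (* Passing from q to its real part x weakens Schwarz-Pick consistently: |x'| <= |q'| and L^2 -
     |q|^2 <= L^2 - x^2. *)
  assert (Hx' : forall t, 0 <= t <= r -> - (L ^ 2 - x t ^ 2) <= x' t * (L * (1 - t ^ 2))).
  { intros t Ht.
    assert (Ht1 : Cmod (t * u) < 1) by (rewrite Hu1; lra).
    assert (S := schwarz_pick q dq L (t * u)%C Hd Hc HL Ht1).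
    rewrite Hu1 in S by exact Ht.
    assert (H1 : Rabs (x' t) <= Cmod (dq (t * u)%C)).
    { eapply Rle_trans; [apply re_le_Cmod|]; rewrite Cmod_mult, Hu; lra. }
    assert (H2 := re_le_Cmod (q (t * u)%C)); fold (x t) in H2.
    assert (H3 : x t ^ 2 <= Cmod (q (t * u)%C) ^ 2).
    { rewrite <- (pow2_abs (x t)); apply pow_incr; split; [apply Rabs_pos|exact H2]. }
    assert (H4 : - x' t <= Cmod (dq (t * u)%C))
      by (rewrite <- Rabs_Ropp in H1; assert (H4 := Rle_abs (- x' t)); lra).
    assert (H5 := HxL t Ht).
    assert (H6 : 0 <= L * (1 - t ^ 2)) by (apply Rmult_le_pos; nra).
    assert (H7 := Rmult_le_compat_r _ _ _ H6 H4); nra. }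
  set (E := fun t : R => ln (L + x t) + ln (1 + t) - ln (L - x t) - ln (1 - t)).
  assert (HE : E 0 <= E r).
  { apply derive_nonneg_le with
      (fun t => x' t * / (L + x t) + / (1 + t) + x' t * / (L - x t) + / (1 - t)); [exact Hr| |].
    - intros t Ht; assert (H1 := HxL t Ht).
      unfold E; auto_derive.
      + repeat split; try lra; eexists; now apply Hx.
      + replace (Derive (fun x0 : R => x x0) t) with (x' t)
          by (symmetry; now apply is_derive_unique, Hx); field; lra.
    - intros t Ht; assert (H1 := HxL t Ht); assert (H2 := Hx' t Ht).
      replace (x' t * / (L + x t) + / (1 + t) + x' t * / (L - x t) + / (1 - t))
        with (2 * (x' t * (L * (1 - t ^ 2)) + (L ^ 2 - x t ^ 2))
              / ((L ^ 2 - x t ^ 2) * (1 - t ^ 2))).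
      + apply Rmult_le_pos; [lra|].
        apply Rlt_le, Rinv_0_lt_compat, Rmult_lt_0_compat; nra.
      + field; repeat split; nra. }
  assert (Hx0 := HxL 0 ltac:(lra)); assert (Hxr := HxL r ltac:(lra)).
  assert (Ex0 : x 0 = Re (q 0)) by (unfold x; f_equal; f_equal; ring).
  assert (Exr : x r = Re (q z)) by (unfold x; now rewrite <- Ez).
  unfold E in HE.
  assert (HE' : ln ((L + x 0) * ((L - x r) * (1 - r))) <= ln ((L + x r) * ((1 + r) * (L - x 0)))).
  { rewrite !ln_mult by (try apply Rmult_lt_0_compat; lra).
    replace (1 + 0) with 1 in HE by ring; replace (1 - 0) with 1 in HE by ring.
    rewrite ln_1 in HE; lra. }
  assert (HP : (L + x 0) * ((L - x r) * (1 - r)) <= (L + x r) * ((1 + r) * (L - x 0))).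
  { apply Rnot_lt_le; intros Hlt; apply ln_increasing in Hlt; [lra|].
    repeat apply Rmult_lt_0_compat; lra. }
  rewrite Ex0 in *; rewrite Exr in *; set (s := Re (q 0)) in *; set (y := Re (q z)) in *.
  apply Rmult_le_reg_r with (L - r); [lra|].
  unfold Rdiv; rewrite Rmult_assoc, Rinv_l, Rmult_1_r by lra.
  (* The worst initial value is s = 1, since L + s increases and L - s decreases with s. The
     resulting inequality is linear in y and solves to the stated bound. *)
  assert (HP1 : (L + 1) * ((L - y) * (1 - r)) <= (L + y) * ((1 + r) * (L - 1))).
  { apply Rle_trans with ((L + s) * ((L - y) * (1 - r))).
    - apply Rmult_le_compat_r; [apply Rmult_le_pos|]; lra.
    - apply Rle_trans with (1 := HP); apply Rmult_le_compat_l; [lra|].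
      apply Rmult_le_compat_l; lra. }
  nra.
Qed.

(** * Partial derivatives and regularity *)

Lemma ex_dx_pder (f : C -> C) (z : C) :
  ex_dx f z -> pder (fun t : R => f (t, Im z)) (Re z) (dx f z).
Proof.
  intros [H1 H2].
  apply cdiff_ext with (fun t : R => (Re (f (t, Im z)), Im (f (t, Im z))));
    [intros; apply C_eta|].
  apply pder_pair; now apply Derive_correct.
Qed.

Lemma ex_dy_pder (f : C -> C) (z : C) :
  ex_dy f z -> pder (fun t : R => f (Re z, t)) (Im z) (dy f z).
Proof.
  intros [H1 H2].
  apply cdiff_ext with (fun t : R => (Re (f (Re z, t)), Im (f (Re z, t))));
    [intros; apply C_eta|].
  apply pder_pair; now apply Derive_correct.
Qed.

Lemma pder_dx (f : C -> C) (z l : C) :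
  pder (fun t : R => f (t, Im z)) (Re z) l -> ex_dx f z /\ dx f z = l.
Proof.
  intros H; assert (H1 := pder_Re _ _ _ H); assert (H2 := pder_Im _ _ _ H).
  split; [split; eexists; eassumption|].
  apply C_ext; now apply is_derive_unique.
Qed.

Lemma pder_dy (f : C -> C) (z l : C) :
  pder (fun t : R => f (Re z, t)) (Im z) l -> ex_dy f z /\ dy f z = l.
Proof.
  intros H; assert (H1 := pder_Re _ _ _ H); assert (H2 := pder_Im _ _ _ H).
  split; [split; eexists; eassumption|].
  apply C_ext; now apply is_derive_unique.
Qed.

Lemma pder_horizontal (x y : R) : pder (fun t : R => ((t, y) : C)) x 1.
Proof.
  exists (fun _ => RtoC 1); split; [apply continuous_const|split; [reflexivity|]].
  intros; C_algebra.
Qed.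

Lemma pder_vertical (x y : R) : pder (fun t : R => ((x, t) : C)) y Ci.
Proof.
  exists (fun _ => Ci); split; [apply continuous_const|split; [reflexivity|]].
  intros; C_algebra.
Qed.

Lemma cder_pder_horizontal (f : C -> C) (z l : C) :
  cder f z l -> pder (fun t : R => f (t, Im z)) (Re z) l.
Proof.
  intros H; rewrite <- (Cmult_1_r l).
  apply (pder_comp f (fun t : R => (t, Im z))); [rewrite C_eta; exact H|].
  apply pder_horizontal.
Qed.

Lemma cder_pder_vertical (f : C -> C) (z l : C) :
  cder f z l -> pder (fun t : R => f (Re z, t)) (Im z) (l * Ci)%C.
Proof.
  intros H.
  apply (pder_comp f (fun t : R => (Re z, t))); [rewrite C_eta; exact H|].
  apply pder_vertical.
Qed.

Lemma pder_ext_loc (f g : R -> C) (t : R) (l : C) :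
  locally t (fun s => f s = g s) -> pder f t l -> pder g t l.
Proof.
  apply cdiff_ext_loc; [apply continuous_RtoC|].
  intros s Hs E; now apply Hs, RtoC_inj.
Qed.

Lemma open_horizontal (U : C -> Prop) (z : C) :
  open U -> U z -> locally (Re z) (fun t : R => U (t, Im z)).
Proof.
  intros HU Hz.
  assert (Hc := cdiff_continuous _ _ _ _ (continuous_RtoC (Re z)) (pder_horizontal (Re z) (Im z))).
  apply Hc; rewrite C_eta; apply HU, Hz.
Qed.

Lemma open_vertical (U : C -> Prop) (z : C) :
  open U -> U z -> locally (Im z) (fun t : R => U (Re z, t)).
Proof.
  intros HU Hz.
  assert (Hc := cdiff_continuous _ _ _ _ (continuous_RtoC (Im z)) (pder_vertical (Re z) (Im z))).
  apply Hc; rewrite C_eta; apply HU, Hz.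
Qed.

Lemma C1_on_intro (U : C -> Prop) (f fx fy : C -> C) : open U ->
  (forall z, U z -> pder (fun t : R => f (t, Im z)) (Re z) (fx z)) ->
  (forall z, U z -> pder (fun t : R => f (Re z, t)) (Im z) (fy z)) ->
  (forall z, U z -> continuous fx z) -> (forall z, U z -> continuous fy z) ->
  C1_on U f.
Proof.
  intros HU Hx Hy Cx Cy z Hz.
  split; [eapply pder_dx, Hx, Hz|split; [eapply pder_dy, Hy, Hz|split]].
  - apply continuous_ext_loc with fx; [|now apply Cx].
    generalize (HU z Hz); apply filter_imp; intros w Hw; symmetry; apply pder_dx, Hx, Hw.
  - apply continuous_ext_loc with fy; [|now apply Cy].
    generalize (HU z Hz); apply filter_imp; intros w Hw; symmetry; apply pder_dy, Hy, Hw.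
Qed.

Lemma C1_on_lin (U : C -> Prop) (f g : C -> C) (a b : C) : open U ->
  C1_on U f -> C1_on U g -> C1_on U (fun z => a * f z + b * g z)%C.
Proof.
  intros HU Hf Hg.
  apply C1_on_intro with (fun z => a * dx f z + b * dx g z)%C
                         (fun z => a * dy f z + b * dy g z)%C; [exact HU| | | |];
    intros z Hz; destruct (Hf z Hz) as (F1 & F2 & F3 & F4);
    destruct (Hg z Hz) as (G1 & G2 & G3 & G4).
  1: apply cdiff_plus; apply cdiff_scal; now apply ex_dx_pder.
  1: apply cdiff_plus; apply cdiff_scal; now apply ex_dy_pder.
  all: apply continuous_Cplus; apply continuous_Cmult; auto; apply continuous_const.
Qed.

Lemma C1_on_conj (U : C -> Prop) (f : C -> C) : open U ->
  C1_on U f -> C1_on U (fun z => Cconj (f z)).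
Proof.
  intros HU Hf.
  apply C1_on_intro with (fun z => Cconj (dx f z)) (fun z => Cconj (dy f z)); [exact HU| | | |];
    intros z Hz; destruct (Hf z Hz) as (F1 & F2 & F3 & F4).
  1: now apply pder_conj, ex_dx_pder.
  1: now apply pder_conj, ex_dy_pder.
  all: now apply continuous_Cconj.
Qed.

Lemma continuity_2d_pt_of_continuous (f : C -> R) (z : C) :
  continuous f z -> continuity_2d_pt (fun x y => f (x, y)) (Re z) (Im z).
Proof.
  destruct z as [x y]; intros H eps; apply locally_2d_locally.
  generalize (H _ (locally_ball (f (x, y)) eps)); unfold filtermap; apply filter_imp.
  intros [u v] Hw; exact Hw.
Qed.

(* Equality of the mixed second derivatives of [Re f]. *)
Lemma cauchy_riemann_half (U : C -> Prop) (f df : C -> C) (z : C) : open U ->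
  (forall z, U z -> cder f z (df z)) -> C1_on U df -> U z ->
  - Im (dx df z) = Re (dy df z).
Proof.
  intros HU Hf Hdf Hz.
  set (u := fun x y : R => Re (f (x, y))).
  assert (Ux : forall w, U w -> is_derive (fun t => u t (Im w)) (Re w) (Re (df w))).
  { intros w Hw; apply pder_Re, cder_pder_horizontal, Hf, Hw. }
  assert (Uy : forall w, U w -> is_derive (fun t => u (Re w) t) (Im w) (- Im (df w))).
  { intros w Hw; rewrite <- re_mult_Ci.
    apply pder_Re, cder_pder_vertical, Hf, Hw. }
  assert (Uyx : forall w, U w ->
            is_derive (fun s => Derive (fun t => u s t) (Im w)) (Re w) (- Im (dx df w))).
  { intros w Hw.
    apply (is_derive_ext_loc (fun s => - Im (df (s, Im w)))).
    - generalize (open_horizontal U w HU Hw); apply filter_imp; intros s Hs.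
      symmetry; apply is_derive_unique, (Uy (s, Im w) Hs).
    - apply (is_derive_opp (V := R_NormedModule) (fun s => Im (df (s, Im w)))).
      apply pder_Im, ex_dx_pder, Hdf, Hw. }
  assert (Uxy : forall w, U w ->
            is_derive (fun s => Derive (fun t => u t s) (Re w)) (Im w) (Re (dy df w))).
  { intros w Hw.
    apply (is_derive_ext_loc (fun s => Re (df (Re w, s)))).
    - generalize (open_vertical U w HU Hw); apply filter_imp; intros s Hs.
      symmetry; apply is_derive_unique, (Ux (Re w, s) Hs).
    - apply pder_Re, ex_dy_pder, Hdf, Hw. }
  assert (HUz : locally_2d (fun x y => U (x, y)) (Re z) (Im z)).
  { apply locally_2d_locally; rewrite C_eta.
    generalize (HU z Hz); apply filter_imp; intros w Hw; now rewrite C_eta. }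
  rewrite <- (is_derive_unique _ _ _ (Uyx z Hz)), <- (is_derive_unique _ _ _ (Uxy z Hz)).
  apply Schwarz.
  - destruct HUz as [d Hd]; exists d; intros x y H1 H2; specialize (Hd x y H1 H2).
    repeat split; eexists.
    + apply (Ux (x, y) Hd).
    + apply (Uy (x, y) Hd).
    + apply (Uyx (x, y) Hd).
    + apply (Uxy (x, y) Hd).
  - apply continuity_2d_pt_ext_loc with (fun x y => - Im (dx df (x, y))).
    + destruct HUz as [d Hd]; exists d; intros x y H1 H2; symmetry.
      apply is_derive_unique, (Uyx (x, y)), Hd; auto.
    + apply continuity_2d_pt_opp, (continuity_2d_pt_of_continuous (fun w => Im (dx df w))).
      apply continuous_Im; destruct (Hdf z Hz) as (_ & _ & H1 & _); exact H1.
  - apply continuity_2d_pt_ext_loc with (fun x y => Re (dy df (x, y))).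
    + destruct HUz as [d Hd]; exists d; intros x y H1 H2; symmetry.
      apply is_derive_unique, (Uxy (x, y)), Hd; auto.
    + apply (continuity_2d_pt_of_continuous (fun w => Re (dy df w))).
      apply continuous_Re; destruct (Hdf z Hz) as (_ & _ & _ & H1); exact H1.
Qed.

Lemma cauchy_riemann (U : C -> Prop) (f df : C -> C) (z : C) : open U ->
  (forall z, U z -> cder f z (df z)) -> C1_on U df -> U z ->
  dy df z = (Ci * dx df z)%C.
Proof.
  intros HU Hf Hdf Hz.
  assert (H1 := cauchy_riemann_half U f df z HU Hf Hdf Hz).
  (* The real part of -i f is Im f, so this gives the other Cauchy-Riemann equation. The summand
     [0 * df w] only brings the derivative into the shape of [C1_on_lin]. *)
  assert (H2 := cauchy_riemann_half U (fun w => - Ci * f w)%C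
                  (fun w => - Ci * df w + 0 * df w)%C z HU).
  destruct (Hdf z Hz) as (F1 & F2 & _).
  assert (Ex : dx (fun w => - Ci * df w + 0 * df w)%C z = (- Ci * dx df z + 0 * dx df z)%C).
  { apply pder_dx, cdiff_plus; apply cdiff_scal; now apply ex_dx_pder. }
  assert (Ey : dy (fun w => - Ci * df w + 0 * df w)%C z = (- Ci * dy df z + 0 * dy df z)%C).
  { apply pder_dy, cdiff_plus; apply cdiff_scal; now apply ex_dy_pder. }
  rewrite Ex, Ey in H2.
  assert (H3 : - Im (- Ci * dx df z + 0 * dx df z)%C = Re (- Ci * dy df z + 0 * dy df z)%C).
  { apply H2; [|now apply C1_on_lin|exact Hz].
    intros w Hw; replace (- Ci * df w + 0 * df w)%C with (- Ci * df w)%C by ring.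
    apply cdiff_scal, Hf, Hw. }
  clear - H1 H3; revert H1 H3; generalize (dx df z) (dy df z); intros [a b] [c d].
  unfold Re, Im; simpl; intros H1 H3; apply C_ext; unfold Re, Im; simpl; lra.
Qed.

Lemma Cmod_le_components (z w : C) :
  Rabs (Re z) <= Rabs (Re w) -> Rabs (Im z) <= Rabs (Im w) -> Cmod z <= Cmod w.
Proof.
  intros H1 H2; apply Rsqr_incr_0; try apply Cmod_ge_0.
  rewrite !Rsqr_pow2, !Cmod2_alt, <- !Rsqr_pow2.
  apply Rplus_le_compat; now apply Rsqr_le_abs_1.
Qed.

(** Go from z vertically to height Im w, where the derivative at the single point z suffices, then
    horizontally to w, where the mean value theorem and the continuity of [ax] at z apply. *)
Lemma little_o_of_partials (a ax : C -> R) (z : C) (ay : R) :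
  locally z (fun w => is_derive (fun t : R => a (t, Im w)) (Re w) (ax w)) ->
  continuous ax z ->
  is_derive (fun t : R => a (Re z, t)) (Im z) ay ->
  forall eps, 0 < eps -> locally z (fun w =>
    Rabs (a w - a z - (ax z * (Re w - Re z) + ay * (Im w - Im z))) <= eps * Cmod (w - z)).
Proof.
  intros Hx Cx Hy eps He.
  assert (He2 : 0 < eps / 2) by lra.
  assert (Hb := Cx _ (locally_ball (ax z) (mkposreal _ He2))); unfold filtermap in Hb.
  destruct (proj1 (locally_C_Cmod _ _) (filter_and _ _ Hx Hb)) as [d1 [Hd1 H1]].
  destruct (caratheodory_is_derive _ _ _ Hy) as [p [Hp [Ep E]]].
  assert (Hp' := Hp _ (locally_ball (p (Im z)) (mkposreal _ He2))).
  destruct (proj1 (locally_R_Rabs _ _) Hp') as [d2 [Hd2 H2]].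
  apply locally_C_Cmod; exists (Rmin d1 d2); split; [now apply Rmin_glb_lt|].
  intros w Hw.
  assert (Hw1 : Cmod (w - z) < d1) by (eapply Rlt_le_trans; [exact Hw|apply Rmin_l]).
  assert (Hw2 : Cmod (w - z) < d2) by (eapply Rlt_le_trans; [exact Hw|apply Rmin_r]).
  assert (HR : Rabs (Re w - Re z) <= Cmod (w - z)) by apply (re_le_Cmod (w - z)).
  assert (HI : Rabs (Im w - Im z) <= Cmod (w - z)) by apply (im_le_Cmod (w - z)).
  assert (Hseg : forall t, Rmin (Re z) (Re w) <= t <= Rmax (Re z) (Re w) ->
            Cmod ((t, Im w) - z) < d1).
  { intros t Ht; eapply Rle_lt_trans; [|exact Hw1].
    apply Cmod_le_components; [|unfold Im; simpl; lra].
    unfold Re in *; simpl.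
    revert Ht; unfold Rmin, Rmax; destruct (Rle_dec (fst z) (fst w)); intros Ht;
      unfold Rabs; repeat destruct Rcase_abs; lra. }
  destruct (MVT_gen (fun t => a (t, Im w)) (Re z) (Re w) (fun t => ax (t, Im w)))
    as [c [Hc Ec]].
  - intros t Ht; apply (H1 (t, Im w)), Hseg; lra.
  - intros t Ht; apply continuity_pt_filterlim, (ex_derive_continuous (fun t => a (t, Im w))).
    eexists; apply (H1 (t, Im w)), Hseg, Ht.
  - rewrite C_eta in Ec; specialize (E (Im w)); rewrite C_eta in E.
    assert (B1 : Rabs (ax (c, Im w) - ax z) < eps / 2) by (apply (H1 (c, Im w)), Hseg, Hc).
    assert (B2 : Rabs (p (Im w) - ay) < eps / 2).
    { rewrite <- Ep; apply H2; eapply Rle_lt_trans; [exact HI|exact Hw2]. }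
    replace (a w - a z - (ax z * (Re w - Re z) + ay * (Im w - Im z)))
      with ((ax (c, Im w) - ax z) * (Re w - Re z) + (p (Im w) - ay) * (Im w - Im z)) by nra.
    eapply Rle_trans; [apply Rabs_triang|]; rewrite !Rabs_mult.
    assert (Q1 := Rabs_pos (ax (c, Im w) - ax z)); assert (Q2 := Rabs_pos (p (Im w) - ay)).
    assert (Q3 := Rabs_pos (Re w - Re z)); assert (Q4 := Rabs_pos (Im w - Im z)).
    nra.
Qed.

(** Both components of [df] have a total differential at z, and by Cauchy-Riemann it is
    multiplication by the complex number [dx df z]. *)
Lemma holomorphic_derivative (U : C -> Prop) (f df : C -> C) (z : C) : open U ->
  (forall z, U z -> cder f z (df z)) -> C1_on U df -> U z -> cder df z (dx df z).
Proof.
  intros HU Hf Hdf Hz.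
  assert (CR := cauchy_riemann U f df z HU Hf Hdf Hz).
  destruct (Hdf z Hz) as (_ & F2 & F3 & _).
  apply cder_of_little_o; intros eps He.
  assert (He2 : 0 < eps / 2) by lra.
  assert (A := fun P1 P2 P3 => little_o_of_partials (fun w => Re (df w)) (fun w => Re (dx df w)) z
                 (Re (dy df z)) P1 P2 P3 _ He2).
  assert (B := fun P1 P2 P3 => little_o_of_partials (fun w => Im (df w)) (fun w => Im (dx df w)) z
                 (Im (dy df z)) P1 P2 P3 _ He2).
  cbv beta in A, B.
  assert (A' : locally z (fun w => is_derive (fun t : R => Re (df (t, Im w))) (Re w) (Re (dx df w)))).
  { generalize (HU z Hz); apply filter_imp; intros w Hw.
    apply pder_Re, ex_dx_pder, Hdf, Hw. }
  assert (B' : locally z (fun w => is_derive (fun t : R => Im (df (t, Im w))) (Re w) (Im (dx df w)))).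
  { generalize (HU z Hz); apply filter_imp; intros w Hw.
    apply pder_Im, ex_dx_pder, Hdf, Hw. }
  specialize (A A' (continuous_Re _ _ F3) (pder_Re _ _ _ (ex_dy_pder _ _ F2))).
  specialize (B B' (continuous_Im _ _ F3) (pder_Im _ _ _ (ex_dy_pder _ _ F2))).
  generalize (filter_and _ _ A B); apply filter_imp; intros w [HA HB].
  rewrite CR in HA, HB; revert HA HB; generalize (dx df z); intros l HA HB.
  eapply Rle_trans; [apply Cmod_le_abs|].
  replace (eps * Cmod (w - z)) with (eps / 2 * Cmod (w - z) + eps / 2 * Cmod (w - z)) by field.
  apply Rplus_le_compat; [refine (Rle_trans _ _ _ _ HA)|refine (Rle_trans _ _ _ _ HB)];
    right; f_equal; unfold Re, Im; simpl; ring.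
Qed.

(** * Univalence and covering *)

Definition rect (a b a' b' : R) (z : C) : Prop := a <= Re z <= b /\ a' <= Im z <= b'.

(** If the infimum m were not attained, compactness would keep F above m by a uniform margin,
    contradicting the choice of m. *)
Lemma rect_minimum (F : C -> R) (a b a' b' : R) (z1 : C) :
  rect a b a' b' z1 ->
  (forall z, rect a b a' b' z -> 0 <= F z) ->
  (forall z, rect a b a' b' z -> continuous F z) ->
  exists z0, rect a b a' b' z0 /\ forall z, rect a b a' b' z -> F z0 <= F z.
Proof.
  intros H1 Hpos HF.
  destruct (completeness (fun y => exists z, rect a b a' b' z /\ y = - F z)) as [s [Hub Hlub]].
  { exists 0; intros y [z [Hz ->]]; specialize (Hpos z Hz); lra. }
  { exists (- F z1), z1; auto. }
  set (m := - s).
  assert (Hm : forall z, rect a b a' b' z -> m <= F z).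
  { intros z Hz; assert (H := Hub (- F z) ltac:(now exists z)); unfold m; lra. }
  apply NNPP; intros Hno.
  assert (Hlt : forall z, rect a b a' b' z -> m < F z).
  { intros z Hz; destruct (Rle_lt_or_eq_dec _ _ (Hm z Hz)) as [H|H]; [exact H|].
    exfalso; apply Hno; exists z; split; [exact Hz|rewrite <- H; exact Hm]. }
  (* A single d serves as radius and as margin over m, so the lower bound that compactness gives for
     the radii is also a uniform margin. Outside the rectangle the value 1 is a dummy. *)
  assert (Hd : forall u v : R, exists d : posreal, rect a b a' b' (u, v) ->
            forall x y, Rabs (x - u) < d -> Rabs (y - v) < d -> m + d < F (x, y)).
  { intros u v; destruct (classic (rect a b a' b' (u, v))) as [Hr|Hr];
      [|exists (mkposreal 1 Rlt_0_1); tauto].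
    assert (He : 0 < (F (u, v) - m) / 2) by (specialize (Hlt _ Hr); lra).
    destruct (HF _ Hr _ (locally_ball (F (u, v)) (mkposreal _ He))) as [d Hd].
    assert (Hp : 0 < Rmin d ((F (u, v) - m) / 2)) by (apply Rmin_glb_lt; [apply cond_pos|exact He]).
    exists (mkposreal _ Hp); simpl; intros _ x y Hx Hy.
    assert (L1 := Rmin_l d ((F (u, v) - m) / 2)); assert (L2 := Rmin_r d ((F (u, v) - m) / 2)).
    assert (HB : Rabs (F (x, y) - F (u, v)) < (F (u, v) - m) / 2).
    { apply (Hd (x, y)); split; simpl.
      - apply Rlt_le_trans with (2 := L1); exact Hx.
      - apply Rlt_le_trans with (2 := L1); exact Hy. }
    apply Rabs_def2 in HB; lra. }
  set (delta := fun u v => proj1_sig (constructive_indefinite_description _ (Hd u v))).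
  destruct (compactness_value_2d a b a' b' delta) as [d Hcover].
  assert (Hbig : forall z, rect a b a' b' z -> m + d < F z).
  { intros [x y] [Hx Hy]; specialize (Hcover x y Hx Hy); apply NNPP in Hcover.
    destruct Hcover as (u & v & Hu & Hv & H2 & H3 & H4).
    apply Rle_lt_trans with (m + delta u v); [lra|].
    unfold delta in *; destruct (constructive_indefinite_description _ (Hd u v)) as [e He].
    simpl in *; apply He; auto; now split. }
  assert (Hs : s <= - (m + d)).
  { apply Hlub; intros y [z [Hz ->]]; specialize (Hbig z Hz); lra. }
  assert (Hd0 := cond_pos d); unfold m in Hs; lra.
Qed.

Lemma Cmod_segment_le (z w : C) (t : R) (r : R) :
  0 <= t <= 1 -> Cmod z <= r -> Cmod w <= r -> Cmod (z + t * (w - z)) <= r.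
Proof.
  intros Ht Hz Hw.
  replace (z + t * (w - z))%C with (RtoC (1 - t) * z + t * w)%C
    by (rewrite RtoC_minus; ring).
  eapply Rle_trans; [apply Cmod_triangle|]; rewrite !Cmod_mult, !Cmod_R, !Rabs_pos_eq by lra.
  nra.
Qed.

Lemma disk_0 (r : R) (z : C) : disk 0 r z <-> Cmod z < r.
Proof. unfold disk; replace (z - 0)%C with z by ring; tauto. Qed.

(** Retraction of the line onto [0, 1]. It extends the lifted path to all real t, as [IVT_cor] wants
    a function continuous everywhere. *)
Definition clamp (t : R) : R := Rmax 0 (Rmin 1 t).

Lemma clamp_bounds (t : R) : 0 <= clamp t <= 1.
Proof. unfold clamp, Rmax, Rmin; repeat destruct Rle_dec; lra. Qed.

Lemma clamp_lipschitz (s t : R) : Rabs (clamp s - clamp t) <= Rabs (s - t).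
Proof.
  unfold clamp, Rmax, Rmin; repeat destruct Rle_dec; unfold Rabs; repeat destruct Rcase_abs; lra.
Qed.

(** * Consequences of a directional lower bound m with primitive P *)

Section Covering.

Variables (f h g dh dg : C -> C) (r2 : R) (m P : R -> R).
Hypothesis r2_pos : 0 < r2.
Hypothesis f_eq : forall z, Cmod z < r2 -> f z = (h z + Cconj (g z))%C.
Hypothesis f_0 : f 0 = 0.
Hypothesis h_der : forall z, Cmod z < r2 -> cder h z (dh z).
Hypothesis g_der : forall z, Cmod z < r2 -> cder g z (dg z).
Hypothesis jac : forall z, Cmod z < r2 -> Cmod (dg z) < Cmod (dh z).
(** The order of quantifiers matters: v is chosen from the direction u before z, so Re (v * f) can
    be followed along any segment of direction u. *)
Hypothesis lower : forall u, Cmod u = 1 -> exists v, Cmod v = 1 /\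
  forall z, Cmod z < r2 -> m (Cmod z) <= Re (v * (dh z * u + Cconj (dg z * u))).
Hypothesis m_pos : forall r, 0 <= r < r2 -> 0 < m r.
Hypothesis m_decr : forall r s, 0 <= r <= s -> s < r2 -> m s <= m r.
Hypothesis P_der : forall r, 0 <= r < r2 -> is_derive P r (m r).
Hypothesis P_cont : continuous P r2.
Hypothesis P_0 : P 0 = 0.

Lemma f_pder_line (z u : C) (t : R) : Cmod (z + t * u) < r2 ->
  pder (fun s : R => f (z + s * u)%C) t
       (dh (z + t * u) * u + Cconj (dg (z + t * u) * u))%C.
Proof.
  intros Ht.
  apply pder_ext_loc with (fun s : R => h (z + s * u) + Cconj (g (z + s * u)))%C.
  - assert (Hc := cdiff_continuous _ _ _ _ (continuous_RtoC t) (pder_line z u t)).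
    generalize (Hc _ (open_disk 0 r2 _ (proj2 (disk_0 _ _) Ht))); unfold filtermap.
    apply filter_imp; intros s Hs; symmetry; apply f_eq, disk_0, Hs.
  - apply cdiff_plus; [|apply pder_conj];
      apply (pder_comp _ (fun s : R => z + s * u)%C); auto; apply pder_line.
Qed.

Lemma f_continuous (z : C) : Cmod z < r2 -> continuous f z.
Proof.
  intros Hz; apply continuous_ext_loc with (fun w => h w + Cconj (g w))%C.
  - generalize (open_disk 0 r2 z (proj2 (disk_0 _ _) Hz)); apply filter_imp.
    intros w Hw; symmetry; apply f_eq, disk_0, Hw.
  - apply continuous_Cplus; [|apply continuous_Cconj]; eapply cder_continuous; eauto.
Qed.

(** Along the segment, which stays in the convex disk of radius r, Re (v * f) grows at rate at least
    m r because m is decreasing. Besides injectivity this gives Lipschitz continuity of the inverse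
    on smaller disks. *)
Lemma f_expands (z1 z2 : C) (r : R) : Cmod z1 <= r -> Cmod z2 <= r -> r < r2 ->
  m r * Cmod (z2 - z1) <= Cmod (f z2 - f z1).
Proof.
  intros H1 H2 Hr.
  destruct (exists_polar (z2 - z1)) as [u [Hu E]]; set (d := Cmod (z2 - z1)) in *.
  assert (Hd := Cmod_ge_0 (z2 - z1)); fold d in Hd.
  destruct (lower u Hu) as [v [Hv Hlow]].
  assert (Hseg : forall t, 0 <= t <= d -> Cmod (z1 + t * u) <= r).
  { intros t Ht; destruct (Req_dec d 0) as [E0|n].
    - replace t with 0 by lra; replace (z1 + 0 * u)%C with z1 by ring; exact H1.
    - replace (z1 + t * u)%C with (z1 + RtoC (t / d) * (z2 - z1))%C.
      + apply Cmod_segment_le; auto; split.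
        * apply Rmult_le_pos; [lra|apply Rlt_le, Rinv_0_lt_compat; lra].
        * apply Rmult_le_reg_r with d; [lra|].
          unfold Rdiv; rewrite Rmult_assoc, Rinv_l; lra.
      + rewrite E, RtoC_div by exact n; field.
        intros E1; apply RtoC_inj in E1; contradiction. }
  assert (H := derive_nonneg_le
    (fun t : R => Re (v * f (z1 + t * u)%C) - m r * t)
    (fun t : R => Re (v * (dh (z1 + t * u) * u + Cconj (dg (z1 + t * u) * u))) - m r * 1)
    0 d Hd).
  assert (Ez : (z1 + d * u)%C = z2) by (rewrite <- E; ring).
  cbv beta in H; rewrite Ez in H; replace (z1 + 0 * u)%C with z1 in H by ring.
  assert (H3 : Re (v * f z1) - m r * 0 <= Re (v * f z2) - m r * d).
  { apply H; intros t Ht; assert (Ht1 := Hseg t Ht).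
    - apply (is_derive_minus (V := R_NormedModule)
               (fun t : R => Re (v * f (z1 + t * u)%C)) (fun t => m r * t)).
      + apply pder_Re, cdiff_scal, f_pder_line; lra.
      + apply (is_derive_scal (fun t => t)), (is_derive_id (K := R_AbsRing)).
    - assert (H4 := Hlow (z1 + t * u)%C ltac:(lra)).
      assert (H5 := m_decr (Cmod (z1 + t * u)) r (conj (Cmod_ge_0 _) Ht1) Hr); lra. }
  assert (H4 := Re_le_Cmod (v * (f z2 - f z1))%C); rewrite Cmod_mult, Hv in H4.
  replace (Re (v * (f z2 - f z1))) with (Re (v * f z2) - Re (v * f z1)) in H4
    by (unfold Re; simpl; ring).
  lra.
Qed.

Lemma f_univalent (z1 z2 : C) : Cmod z1 < r2 -> Cmod z2 < r2 -> f z1 = f z2 -> z1 = z2.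
Proof.
  intros H1 H2 E.
  set (r := Rmax (Cmod z1) (Cmod z2)).
  assert (Hr : r < r2) by (now apply Rmax_lub_lt).
  assert (H := f_expands z1 z2 r (Rmax_l _ _) (Rmax_r _ _) Hr).
  rewrite E in H; replace (f z2 - f z2)%C with (RtoC 0) in H by ring; rewrite Cmod_0 in H.
  assert (H0 : 0 <= r) by (eapply Rle_trans; [apply (Cmod_ge_0 z1)|apply Rmax_l]).
  assert (Hm := m_pos r (conj H0 Hr)); assert (Hc := Cmod_ge_0 (z2 - z1)).
  symmetry; apply Ceq_minus, Cmod_eq_0; nra.
Qed.

Lemma f_growth (z : C) : Cmod z < r2 -> P (Cmod z) <= Cmod (f z).
Proof.
  intros Hz; destruct (exists_polar z) as [u [Hu E]]; set (d := Cmod z) in *.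
  assert (Hd := Cmod_ge_0 z); fold d in Hd.
  destruct (lower u Hu) as [v [Hv Hlow]].
  assert (Hseg : forall t, 0 <= t <= d -> Cmod (0 + t * u) = t).
  { intros t Ht; replace (0 + t * u)%C with (t * u)%C by ring.
    rewrite Cmod_mult, Hu, Cmod_R, Rabs_pos_eq; lra. }
  assert (H := derive_nonneg_le
    (fun t : R => Re (v * f (0 + t * u)%C) - P t)
    (fun t : R => Re (v * (dh (0 + t * u) * u + Cconj (dg (0 + t * u) * u))) - m t)
    0 d Hd).
  cbv beta in H.
  replace (0 + d * u)%C with z in H by (rewrite E at 1; ring).
  replace (0 + 0 * u)%C with (RtoC 0) in H by ring.
  assert (H3 : Re (v * f 0) - P 0 <= Re (v * f z) - P d).
  { apply H; intros t Ht; assert (Ht1 := Hseg t Ht).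
    - apply (is_derive_minus (V := R_NormedModule) (fun t : R => Re (v * f (0 + t * u)%C)) P).
      + apply pder_Re, cdiff_scal, f_pder_line; lra.
      + apply P_der; lra.
    - assert (H4 := Hlow (0 + t * u)%C ltac:(lra)); rewrite Ht1 in H4; lra. }
  rewrite f_0, P_0 in H3; replace (Re (v * 0)) with 0 in H3 by (unfold Re; simpl; ring).
  assert (H4 := Re_le_Cmod (v * f z)%C); rewrite Cmod_mult, Hv in H4; lra.
Qed.

Lemma P_incr (r s : R) : 0 <= r < s -> s < r2 -> P r < P s.
Proof.
  intros Hr Hs.
  assert (H := derive_nonneg_le (fun t => P t - m s * t) (fun t => m t - m s * 1) r s).
  assert (Hm := m_pos s ltac:(lra)); cbv beta in H.
  assert (P r - m s * r <= P s - m s * s); [|nra].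
  apply H; [lra| |].
  - intros t Ht; apply (is_derive_minus (V := R_NormedModule) P (fun t => m s * t)).
    + apply P_der; lra.
    + apply (is_derive_scal (fun t => t)), (is_derive_id (K := R_AbsRing)).
  - intros t Ht; assert (H1 := m_decr t s ltac:(lra) Hs); lra.
Qed.

Lemma P_approx (y : R) : y < P r2 -> exists r, 0 < r < r2 /\ y < P r.
Proof.
  intros Hy; assert (He : 0 < P r2 - y) by lra.
  assert (H := P_cont _ (locally_ball (P r2) (mkposreal _ He))); unfold filtermap in H.
  apply locally_R_Rabs in H; destruct H as [d [Hd H]].
  set (r := r2 - Rmin (d / 2) (r2 / 2)).
  assert (H1 : 0 < Rmin (d / 2) (r2 / 2)) by (apply Rmin_glb_lt; lra).
  assert (H2 := Rmin_l (d / 2) (r2 / 2)); assert (H3 := Rmin_r (d / 2) (r2 / 2)).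
  exists r; split; [unfold r; lra|].
  assert (HB : Rabs (P r - P r2) < P r2 - y).
  { apply (H r); unfold r; rewrite Rabs_left; lra. }
  apply Rabs_def2 in HB; lra.
Qed.

(** The sign of the derivative is known only before r2: strict growth is gained up to the midpoint
    s, and P s <= P r2 follows from continuity at r2. *)
Lemma P_lt_r2 (r : R) : 0 <= r < r2 -> P r < P r2.
Proof.
  intros Hr; set (s := (r + r2) / 2).
  apply Rlt_le_trans with (P s); [apply P_incr; unfold s; lra|].
  apply Rnot_lt_le; intros Hlt.
  assert (He : 0 < P s - P r2) by lra.
  assert (H := P_cont _ (locally_ball (P r2) (mkposreal _ He))); unfold filtermap in H.
  apply locally_R_Rabs in H; destruct H as [d [Hd H]].
  set (t := r2 - Rmin (d / 2) ((r2 - s) / 2)).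
  assert (Hs : r < s < r2) by (unfold s; lra).
  assert (H1 : 0 < Rmin (d / 2) ((r2 - s) / 2)) by (apply Rmin_glb_lt; lra).
  assert (H2 := Rmin_l (d / 2) ((r2 - s) / 2)); assert (H3 := Rmin_r (d / 2) ((r2 - s) / 2)).
  assert (HB : Rabs (P t - P r2) < P s - P r2).
  { apply (H t); unfold t; rewrite Rabs_left; lra. }
  apply Rabs_def2 in HB.
  assert (P s < P t) by (apply P_incr; unfold t; lra); lra.
Qed.

(** A priori bound: growth keeps preimages of values below P r away from the boundary circle. Both
    the stepping argument and the lifting of rays rest on it. *)
Lemma Cmod_lt_of_f (z : C) (r : R) : 0 < r < r2 -> Cmod z < r2 -> Cmod (f z) < P r -> Cmod z < r.
Proof.
  intros Hr Hz Hf; apply Rnot_le_lt; intros Hle.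
  assert (H := f_growth z Hz).
  destruct Hle as [Hlt|E]; [|rewrite <- E in H; lra].
  assert (H1 := P_incr r (Cmod z) ltac:(lra) Hz); lra.
Qed.

(* The differential of [f] is onto where the Jacobian is positive, so [|f - w|]
   has no critical point off the zeros of [f - w]. *)
Lemma local_minimum_is_solution (z w : C) (e : R) : Cmod z < r2 -> 0 < e ->
  (forall y, Cmod (y - z) < e -> Cmod (f z - w) <= Cmod (f y - w)) -> f z = w.
Proof.
  intros Hz He Hmin.
  set (a := dh z); set (b := dg z); set (D := (f z - w)%C).
  assert (HJ : 0 < Cmod a ^ 2 - Cmod b ^ 2).
  { assert (H := jac z Hz); fold a b in H; assert (H0 := Cmod_ge_0 b); nra. }
  assert (HJC : (a * Cconj a - b * Cconj b)%C <> 0).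
  { rewrite <- !Cmod2_conj, <- RtoC_minus; intros E; apply RtoC_inj in E; lra. }
  (* Solution by Cramer's rule of the real-linear equation a zeta + conj (b zeta) = D, with
     determinant |a|^2 - |b|^2. In the direction zeta the derivative of f - w is f(z) - w itself, so
     |f - w|^2 has derivative 2 |D|^2, which must vanish at a minimum. *)
  set (zeta := ((Cconj a * D - Cconj b * Cconj D) / (a * Cconj a - b * Cconj b))%C).
  assert (Ez : (a * zeta + Cconj (b * zeta))%C = D).
  { unfold zeta; rewrite !Cmult_conj, Cdiv_conj, !Cminus_conj, !Cmult_conj, !Cconj_conj by exact HJC.
    replace (Cconj a * a - Cconj b * b)%C with (a * Cconj a - b * Cconj b)%C by ring.
    field; exact HJC. }
  assert (Hp : pder (fun s : R => f (z + s * zeta) + - w)%C 0 D).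
  { rewrite <- Ez, <- (Cplus_0_r (a * zeta + _)).
    apply cdiff_plus; [|apply cdiff_const].
    assert (E0 : (z + 0 * zeta)%C = z) by ring.
    unfold a, b; rewrite <- E0 at 1 2; apply f_pder_line; now rewrite E0. }
  assert (HR := pder_Re _ _ _ Hp); assert (HI := pder_Im _ _ _ Hp); cbv beta in HR, HI.
  set (phi := fun s : R => Re (f (z + s * zeta) + - w) * Re (f (z + s * zeta) + - w)
                        + Im (f (z + s * zeta) + - w) * Im (f (z + s * zeta) + - w)).
  assert (Ephi : forall s, phi s = Cmod (f (z + s * zeta) - w) ^ 2).
  { intros s; rewrite Cmod2_alt; unfold phi, Cminus; ring. }
  assert (E0 : (f (z + 0 * zeta) + - w)%C = D).
  { replace (z + 0 * zeta)%C with z by ring; reflexivity. }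
  assert (Hphi : is_derive phi 0 (2 * Cmod D ^ 2)).
  { replace (2 * Cmod D ^ 2) with
      ((Re D * Re (f (z + 0 * zeta) + - w) + Re (f (z + 0 * zeta) + - w) * Re D)
       + (Im D * Im (f (z + 0 * zeta) + - w) + Im (f (z + 0 * zeta) + - w) * Im D)).
    - apply (is_derive_plus (V := R_NormedModule));
        (apply (is_derive_mult (K := R_AbsRing)); [assumption|assumption|exact Rmult_comm]).
    - rewrite E0, Cmod2_alt; ring. }
  apply is_derive_Reals in Hphi.
  (* For |s| < eta the point z + s zeta stays within e of z; the added 1 covers zeta = 0. *)
  set (eta := e / (Cmod zeta + 1)).
  assert (Hz0 := Cmod_ge_0 zeta).
  assert (Heta : 0 < eta) by (apply Rdiv_lt_0_compat; lra).
  assert (H0 := deriv_minimum phi (- eta) eta 0 (exist _ _ Hphi)).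
  change (- eta < 0 -> 0 < eta -> (forall x : R, - eta < x -> x < eta -> phi 0 <= phi x) ->
          2 * Cmod D ^ 2 = 0) in H0.
  assert (HD : 2 * Cmod D ^ 2 = 0).
  { apply H0; try lra; intros s H1 H2; rewrite !Ephi.
    replace (z + 0 * zeta)%C with z by ring.
    apply pow_incr; split; [apply Cmod_ge_0|]; apply Hmin.
    replace (z + s * zeta - z)%C with (s * zeta)%C by ring; rewrite Cmod_mult, Cmod_R.
    assert (Hs : Rabs s < eta) by (apply Rabs_def1; lra).
    apply Rle_lt_trans with (eta * Cmod zeta); [apply Rmult_le_compat_r; lra|].
    apply Rlt_le_trans with (eta * (Cmod zeta + 1)); [nra|].
    right; unfold eta; field; lra. }
  apply Ceq_minus, Cmod_eq_0; fold D; nra.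
Qed.

(** Minimise |f - w| over a square of half side d. A minimiser at distance d or more from z1 is
    impossible: expansion would put its value at least m r * d from f z1, whereas both values lie
    within m r * d / 2 of w. So the minimum is interior and solves f = w. *)
Lemma f_local_surjective (z1 w : C) (r d : R) : 0 < d -> Cmod z1 + 2 * d <= r -> r < r2 ->
  Cmod (w - f z1) < m r * d / 2 -> exists z, Cmod (z - z1) <= 2 * d /\ f z = w.
Proof.
  intros Hd Hr Hr2 Hw.
  assert (Hz1 := Cmod_ge_0 z1); assert (Hm := m_pos r ltac:(lra)).
  set (Q := rect (Re z1 - d) (Re z1 + d) (Im z1 - d) (Im z1 + d)).
  assert (HQ : forall z, Q z -> Cmod (z - z1) <= 2 * d).
  { intros z [H1 H2]; eapply Rle_trans; [apply Cmod_le_abs|].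
    assert (Rabs (Re (z - z1)) <= d) by (apply Rabs_le; unfold Re in *; simpl; lra).
    assert (Rabs (Im (z - z1)) <= d) by (apply Rabs_le; unfold Im in *; simpl; lra).
    lra. }
  assert (HQr : forall z, Q z -> Cmod z <= r).
  { intros z Hz; specialize (HQ z Hz); assert (H := Cmod_minus_ge z z1); lra. }
  assert (HQ1 : Q z1) by (split; lra).
  destruct (rect_minimum (fun z => Cmod (f z - w)) (Re z1 - d) (Re z1 + d)
              (Im z1 - d) (Im z1 + d) z1) as [z0 [Hz0 Hmin]]; auto.
  { intros; apply Cmod_ge_0. }
  { intros z Hz; apply HQr in Hz.
    assert (Hc : continuous f z) by (apply f_continuous; lra).
    intros V [eps HV].
    generalize (proj1 (continuous_C_eps _ _) Hc eps (cond_pos eps)); unfold filtermap.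
    apply filter_imp; intros y Hy; apply HV.
    change (Rabs (Cmod (f y - w) - Cmod (f z - w)) < eps).
    assert (H1 := Cmod_minus_chasles (f y) (f z) w).
    assert (H2 := Cmod_minus_chasles (f z) (f y) w).
    rewrite (Cmod_minus_sym (f z) (f y)) in H2; apply Rabs_def1; lra. }
  fold Q in Hz0.
  exists z0; split; [now apply HQ|].
  assert (Hnear : Cmod (z0 - z1) < d).
  { apply Rnot_le_lt; intros Hge.
    assert (H1 := f_expands z1 z0 r ltac:(lra) (HQr _ Hz0) Hr2).
    assert (H2 := Hmin z1 HQ1); rewrite (Cmod_minus_sym (f z1) w) in H2.
    assert (H3 := Cmod_minus_chasles (f z0) w (f z1)).
    assert (H4 : m r * d <= m r * Cmod (z0 - z1)) by (apply Rmult_le_compat_l; lra).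
    lra. }
  apply local_minimum_is_solution with (d - Cmod (z0 - z1)).
  - specialize (HQr _ Hz0); lra.
  - lra.
  - intros y Hy; apply Hmin.
    assert (H1 := Cmod_minus_chasles y z0 z1).
    assert (H2 := re_le_Cmod (y - z1)); assert (H3 := im_le_Cmod (y - z1)).
    assert (H4 : Rabs (Re (y - z1)) < d) by lra; assert (H5 : Rabs (Im (y - z1)) < d) by lra.
    apply Rabs_def2 in H4, H5; unfold Q, rect, Re, Im in *; simpl in *; lra.
Qed.

Lemma f_surjective (w : C) : Cmod w < P r2 -> exists z, Cmod z < r2 /\ f z = w.
Proof.
  intros Hw; destruct (P_approx _ Hw) as [r' [Hr' HP]].
  (* A preimage of modulus below r' has room 2 d up to r, so one step length, m r * d / 2, works all
     along the ray. *)
  set (r := (r' + r2) / 2); set (d := (r - r') / 2).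
  assert (Hr : r' < r < r2) by (unfold r; lra).
  assert (Hd : 0 < d) by (unfold d; lra).
  assert (Hm := m_pos r ltac:(lra)).
  assert (He : 0 < m r * d / 2) by nra.
  assert (Hw0 := Cmod_ge_0 w).
  destruct (archimed_cor1 (m r * d / 2 / (Cmod w + 1))) as [n [Hn Hn0]];
    [apply Rdiv_lt_0_compat; lra|].
  assert (HN : 0 < INR n) by (now apply lt_0_INR).
  assert (Hstep : / INR n * Cmod w < m r * d / 2).
  { apply Rle_lt_trans with (/ INR n * (Cmod w + 1)).
    - apply Rmult_le_compat_l; [apply Rlt_le, Rinv_0_lt_compat, HN|lra].
    - apply Rlt_le_trans with (m r * d / 2 / (Cmod w + 1) * (Cmod w + 1)).
      + apply Rmult_lt_compat_r; lra.
      + right; field; lra. }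
  assert (H : forall k : nat, (k <= n)%nat ->
            exists z, Cmod z < r2 /\ f z = (RtoC (INR k / INR n) * w)%C).
  { induction k as [|k IH]; intros Hk.
    - exists (RtoC 0); rewrite Cmod_0; split; [lra|]; rewrite f_0; simpl.
      replace (0 / INR n) with 0 by (field; lra); ring.
    - destruct IH as [z [Hz E]]; [now apply Nat.lt_le_incl|].
      (* The previous step only gave |z| < r2; the a priori bound restores |z| < r', so the room
         does not shrink during the induction. *)
      assert (Hz' : Cmod z < r').
      { apply Cmod_lt_of_f; auto; rewrite E, Cmod_mult, Cmod_R.
        apply Rle_lt_trans with (2 := HP); rewrite <- (Rmult_1_l (Cmod w)) at 2.
        apply Rmult_le_compat_r; [exact Hw0|].
        assert (HK : INR k <= INR n) by (apply le_INR; now apply Nat.lt_le_incl).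
        assert (HK0 := pos_INR k).
        rewrite Rabs_pos_eq.
        - apply Rmult_le_reg_r with (INR n); [exact HN|].
          unfold Rdiv; rewrite Rmult_assoc, Rinv_l; lra.
        - apply Rmult_le_pos; [exact HK0|apply Rlt_le, Rinv_0_lt_compat, HN]. }
      destruct (f_local_surjective z (RtoC (INR (S k) / INR n) * w)%C r d) as [y [Hy Ey]];
        [exact Hd|unfold d; lra|lra| |].
      + rewrite E, S_INR.
        replace (RtoC ((INR k + 1) / INR n) * w - RtoC (INR k / INR n) * w)%C
          with (RtoC (/ INR n) * w)%C.
        * rewrite Cmod_mult, Cmod_R, Rabs_pos_eq; [exact Hstep|].
          apply Rlt_le, Rinv_0_lt_compat, HN.
        * transitivity ((RtoC ((INR k + 1) / INR n) - RtoC (INR k / INR n)) * w)%C; [|ring].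
          rewrite <- RtoC_minus; f_equal; f_equal; field; lra.
      + exists y; split; [|exact Ey].
        assert (H := Cmod_minus_ge y z); unfold d in Hy; lra. }
  destruct (H n (le_n n)) as [z [Hz E]]; exists z; split; [exact Hz|].
  rewrite E; replace (INR n / INR n) with 1 by (field; lra); ring.
Qed.

(** The whole preimage of the target disk within the disk of radius r2: its image is then exactly
    that disk, and connectedness is what remains to be shown. *)
Let Omega (z : C) : Prop := Cmod z < r2 /\ Cmod (f z) < P r2.

Lemma Omega_open : open Omega.
Proof.
  intros z [H1 H2].
  assert (A := open_disk 0 r2 z (proj2 (disk_0 _ _) H1)).
  assert (B := f_continuous z H1 _ (open_disk 0 (P r2) _ (proj2 (disk_0 _ _) H2))).
  unfold filtermap in B.
  generalize (filter_and _ _ A B); apply filter_imp; intros y [Ha Hb].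
  split; now apply disk_0.
Qed.

(* The ray from [0] to [f v] lifts to a Lipschitz path from [0] to [v]. *)
Lemma Omega_separation (U V : C -> Prop) (v : C) : open U -> open V ->
  (forall z, Omega z <-> U z \/ V z) -> (forall z, U z -> V z -> False) ->
  U 0 -> V v -> False.
Proof.
  intros HU HV Hcov Hdis HU0 HVv.
  assert (Hv : Omega v) by (apply Hcov; auto); destruct Hv as [Hv1 Hv2].
  destruct (P_approx _ Hv2) as [r' [Hr' HP]].
  assert (Hex : forall t, exists z, Cmod z < r' /\ f z = (clamp t * f v)%C).
  { intros t; assert (Ht := clamp_bounds t); assert (H0 := Cmod_ge_0 (f v)).
    assert (Hle : Cmod (clamp t * f v) <= Cmod (f v))
      by (rewrite Cmod_mult, Cmod_R, Rabs_pos_eq; nra).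
    destruct (f_surjective (clamp t * f v)%C) as [z [Hz E]]; [lra|].
    exists z; split; [|exact E]; apply Cmod_lt_of_f; auto; rewrite E; lra. }
  set (c := fun t => proj1_sig (constructive_indefinite_description _ (Hex t))).
  assert (Hc : forall t, Cmod (c t) < r' /\ f (c t) = (clamp t * f v)%C)
    by (intros t; unfold c; apply proj2_sig).
  assert (HO : forall t, U (c t) \/ V (c t)).
  { intros t; apply Hcov; destruct (Hc t) as [H1 H2]; split; [lra|].
    assert (Ht := clamp_bounds t); assert (H0 := Cmod_ge_0 (f v)).
    rewrite H2, Cmod_mult, Cmod_R, Rabs_pos_eq; nra. }
  assert (Hm := m_pos r' ltac:(lra)).
  (* The path is built by choice; its continuity comes from [f_expands], since m r' |c(s) - c(t)| is
     at most |f(c(s)) - f(c(t))|. *)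
  assert (Hcont : forall t, continuous c t).
  { intros t; apply continuous_C_eps; intros eps He; apply locally_R_Rabs.
    assert (H0 := Cmod_ge_0 (f v)).
    exists (m r' * eps / (Cmod (f v) + 1)); split; [apply Rdiv_lt_0_compat; nra|].
    intros s Hs; destruct (Hc s) as [S1 S2]; destruct (Hc t) as [T1 T2].
    assert (H1 := f_expands (c t) (c s) r' ltac:(lra) ltac:(lra) ltac:(lra)).
    rewrite S2, T2 in H1.
    replace (clamp s * f v - clamp t * f v)%C with (RtoC (clamp s - clamp t) * f v)%C in H1
      by (rewrite RtoC_minus; ring).
    rewrite Cmod_mult, Cmod_R in H1.
    assert (H2 := clamp_lipschitz s t).
    apply Rmult_lt_reg_l with (m r'); [exact Hm|].
    apply Rle_lt_trans with (1 := H1).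
    apply Rle_lt_trans with (Rabs (s - t) * (Cmod (f v) + 1)).
    - apply Rmult_le_compat; try lra; apply Rabs_pos.
    - replace (m r' * eps) with (m r' * eps / (Cmod (f v) + 1) * (Cmod (f v) + 1))
        by (field; lra).
      apply Rmult_lt_compat_r; lra. }
  (* Locally constant because U and V are open and disjoint; going from 1 at t = 0 to -1 at t = 1 it
     would have to take the value 0. *)
  set (chi := fun t => if excluded_middle_informative (U (c t)) then 1 else -1).
  assert (Hchi : continuity chi).
  { intros t; apply continuity_pt_filterlim.
    change (continuous chi t).
    apply continuous_ext_loc with (fun _ : R => chi t); [|apply continuous_const].
    destruct (HO t) as [Ht|Ht].
    - generalize (Hcont t _ (HU _ Ht)); unfold filtermap; apply filter_imp; intros s Hs.
      unfold chi; now do 2 destruct excluded_middle_informative.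
    - generalize (Hcont t _ (HV _ Ht)); unfold filtermap; apply filter_imp; intros s Hs.
      unfold chi; do 2 destruct excluded_middle_informative; auto; exfalso; eauto. }
  assert (E0 : c 0 = 0).
  { destruct (Hc 0) as [H1 H2]; apply f_univalent; [lra|rewrite Cmod_0; lra|].
    rewrite H2, f_0; replace (clamp 0) with 0; [ring|].
    unfold clamp; rewrite Rmin_right, Rmax_left; lra. }
  assert (E1 : c 1 = v).
  { destruct (Hc 1) as [H1 H2]; apply f_univalent; [lra|exact Hv1|].
    rewrite H2; replace (clamp 1) with 1; [ring|].
    unfold clamp; rewrite Rmin_left, Rmax_right; lra. }
  destruct (IVT_cor chi 0 1 Hchi) as [t [_ Ht]]; [lra| |].
  - unfold chi; rewrite E0, E1.
    destruct (excluded_middle_informative (U 0)); [|contradiction].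
    destruct (excluded_middle_informative (U v)); [exfalso; eauto|lra].
  - unfold chi in Ht; destruct excluded_middle_informative; lra.
Qed.

Lemma f_contains_schlicht_disk : r2 <= 1 -> contains_schlicht_disk f r2 0 (P r2).
Proof.
  intros Hr2.
  assert (HO0 : Omega 0).
  { split; [rewrite Cmod_0; exact r2_pos|].
    rewrite f_0, Cmod_0, <- P_0; apply P_lt_r2; lra. }
  exists Omega; repeat apply conj.
  - now exists (RtoC 0).
  - exact Omega_open.
  - intros U V HU HV Hcov [u Hu] [v Hv].
    apply NNPP; intros Hno.
    assert (Hdis : forall z, U z -> V z -> False) by (intros z H1 H2; apply Hno; eauto).
    destruct (proj1 (Hcov 0) HO0) as [H0|H0].
    + apply (Omega_separation U V v); auto.
    + apply (Omega_separation V U u); auto.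
      * intros z; rewrite Hcov; tauto.
      * intros z H1 H2; eauto.
  - intros z [H1 _]; split; apply disk_0; lra.
  - intros z1 z2 [H1 _] [H2 _]; now apply f_univalent.
  - intros w; rewrite disk_0; split.
    + intros Hw; destruct (f_surjective w Hw) as [z [Hz E]]; exists z.
      split; [split; [exact Hz|now rewrite E]|exact E].
    + intros [z [[_ H] E]]; now rewrite <- E.
Qed.

End Covering.

(** * Quasiregular harmonic mappings *)

(** Identifies h' and conj g' with derivatives of f, so that the C2 regularity of f passes to h' and
    g'. *)
Lemma wirtinger (U : C -> Prop) (f h g : C -> C) (z l k : C) : open U ->
  (forall z, U z -> f z = (h z + Cconj (g z))%C) -> U z ->
  cder h z l -> cder g z k -> dz f z = l /\ dzbar f z = Cconj k.
Proof.
  intros HU Hf Hz Hh Hg.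
  assert (Ex : dx f z = (l + Cconj k)%C).
  { apply pder_dx, pder_ext_loc with (fun t : R => h (t, Im z) + Cconj (g (t, Im z)))%C.
    - generalize (open_horizontal U z HU Hz); apply filter_imp; intros t Ht.
      symmetry; apply Hf, Ht.
    - apply cdiff_plus; [|apply pder_conj]; now apply cder_pder_horizontal. }
  assert (Ey : dy f z = (l * Ci + Cconj (k * Ci))%C).
  { apply pder_dy, pder_ext_loc with (fun t : R => h (Re z, t) + Cconj (g (Re z, t)))%C.
    - generalize (open_vertical U z HU Hz); apply filter_imp; intros t Ht.
      symmetry; apply Hf, Ht.
    - apply cdiff_plus; [|apply pder_conj]; now apply cder_pder_vertical. }
  unfold dz, dzbar; rewrite Ex, Ey; split; C_algebra.
Qed.

Lemma C1_on_dz (U : C -> Prop) (f : C -> C) : open U -> C2_on U f -> C1_on U (dz f).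
Proof.
  intros HU [_ [Hx Hy]].
  replace (dz f) with (fun z => / 2 * dx f z + (- Ci / 2) * dy f z)%C.
  - now apply C1_on_lin.
  - apply functional_extensionality; intros z; unfold dz; field.
Qed.

Lemma C1_on_dzbar (U : C -> Prop) (f : C -> C) : open U -> C2_on U f -> C1_on U (dzbar f).
Proof.
  intros HU [_ [Hx Hy]].
  replace (dzbar f) with (fun z => / 2 * dx f z + (Ci / 2) * dy f z)%C.
  - now apply C1_on_lin.
  - apply functional_extensionality; intros z; unfold dzbar; field.
Qed.

Lemma directional_lower_bound (a b da db : C -> C) (s L : R) : 0 < s ->
  (forall z, s * Cmod z < 1 -> cder a z (da z)) ->
  (forall z, s * Cmod z < 1 -> cder b z (db z)) ->
  (forall z, s * Cmod z < 1 -> continuous da z) ->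
  (forall z, s * Cmod z < 1 -> continuous db z) ->
  (forall z, s * Cmod z < 1 -> Cmod (a z) + Cmod (b z) < L) ->
  1 <= Cmod (a 0) - Cmod (b 0) ->
  forall u, Cmod u = 1 -> exists v, Cmod v = 1 /\ forall z, s * Cmod z < 1 ->
    L * (1 - L * (s * Cmod z)) / (L - s * Cmod z) <= Re (v * (a z * u + Cconj (b z * u))).
Proof.
  intros Hs Ha Hb Ca Cb HL H0 u Hu.
  destruct (exists_unit_mult_real (a 0 * u + Cconj (b 0 * u))%C) as [v [Hv Ev]].
  exists v; split; [exact Hv|]; intros z Hz.
  assert (Hs0 : RtoC s <> 0) by (intros E; apply RtoC_inj in E; lra).
  (* Rescales the unit disk to |z| < 1/s, where the bound L holds. *)
  set (T := fun w : C => (/ s * w + 0)%C).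
  assert (HT : forall w, Cmod w < 1 -> s * Cmod (T w) < 1).
  { intros w Hw; unfold T; rewrite Cplus_0_r, Cmod_mult, Cmod_inv, Cmod_R, Rabs_pos_eq by (auto; lra).
    rewrite <- Rmult_assoc, Rinv_r; lra. }
  (* Conjugating the second term leaves its real part unchanged and moves the conjugate from b to
     the constant v, which makes q holomorphic. *)
  set (q := fun w => (v * u * a (T w) + Cconj v * u * b (T w))%C).
  assert (Eq : forall w, Re (q w) = Re (v * (a (T w) * u + Cconj (b (T w) * u)))).
  { intros w; unfold q, Re; simpl; ring. }
  assert (ETz : T (s * z)%C = z) by (unfold T; field; exact Hs0).
  assert (ET0 : T 0 = 0) by (unfold T; ring).
  assert (HTc : forall w, cder T w (/ s)%C) by (intros w; apply cder_affine).
  assert (Hsz : Cmod (s * z) = s * Cmod z) by (rewrite Cmod_mult, Cmod_R, Rabs_pos_eq; lra).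
  rewrite <- ETz at 3 4; rewrite <- Eq, <- Hsz.
  apply Re_radial_lower_bound with
    (fun w => v * u * (da (T w) * / s) + Cconj v * u * (db (T w) * / s))%C.
  - intros w Hw; apply cdiff_plus; apply cdiff_scal; apply cder_comp; auto.
  - intros w Hw; apply continuous_Cplus; (apply continuous_Cmult; [apply continuous_const|]);
      (apply continuous_Cmult; [|apply continuous_const]).
    + apply (continuous_comp T da); [eapply cder_continuous, HTc|auto].
    + apply (continuous_comp T db); [eapply cder_continuous, HTc|auto].
  - intros w Hw; eapply Rle_lt_trans; [apply Cmod_triangle|].
    rewrite !Cmod_mult, Cmod_conj, Hu, Hv, !Rmult_1_l; auto.
  (* By the choice of v, Re q(0) is |a(0) u + conj (b(0) u)|, at least |a(0)| - |b(0)|. *)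
  - rewrite Eq, ET0, Ev, re_RtoC.
    replace (a 0 * u + Cconj (b 0 * u))%C with (a 0 * u - - Cconj (b 0 * u))%C by ring.
    assert (H := Cmod_minus_ge (a 0 * u) (- Cconj (b 0 * u))).
    rewrite Cmod_opp, Cmod_conj, !Cmod_mult, Hu in H; lra.
  - rewrite Hsz; exact Hz.
Qed.

Theorem theorem3p2 (K M : R) (f h g : C -> C)
    (hK : 1 <= K)
    (hh : analytic_on unit_disk h)
    (hg : analytic_on unit_disk g)
    (hf : forall z : C, unit_disk z -> f z = (h z + Cconj (g z))%C)
    (hqr : quasiregular_harmonic K f)
    (hf0 : f 0 = 0)
    (hlambda : lambda f 0 = 1)
    (hM : forall z : C, unit_disk z -> Cmod (h z) <= M) :
  let r2 := (K + 1) / (3 * sqrt 3 * K * M) in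
  let r3 := sqrt 3 * K * M / (K + 1) *
    (1 + ((3 * K * M / (K + 1)) ^ 2 - 1) *
         ln (1 - (K + 1) ^ 2 / (9 * K ^ 2 * M ^ 2))) in
  1 <= M /\
  univalent_on (disk 0 r2) f /\
  contains_schlicht_disk f r2 0 r3.
Proof.
  intros r2 r3.
  destruct hqr as [[HC2 _] [Hsp HK]].
  assert (HU : open unit_disk) by apply open_disk.
  assert (D0 : forall z, Cmod z < 1 -> unit_disk z) by (intros z Hz; apply disk_0, Hz).
  (* These are h' and g', written through f to make its regularity available. *)
  set (a := dz f); set (b := fun z => Cconj (dzbar f z)).
  assert (Hha : forall z, Cmod z < 1 -> cder h z (a z) /\ cder g z (b z)).
  { intros z Hz; apply D0 in Hz.
    destruct (hh z Hz) as [l Hl]; apply cder_of_is_derive in Hl.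
    destruct (hg z Hz) as [k Hk]; apply cder_of_is_derive in Hk.
    destruct (wirtinger unit_disk f h g z l k HU hf Hz Hl Hk) as [E1 E2].
    unfold a, b; rewrite E1, E2, Cconj_conj; auto. }
  assert (Ha1 : C1_on unit_disk a) by (now apply C1_on_dz).
  assert (Hb1 : C1_on unit_disk b) by (now apply C1_on_conj, C1_on_dzbar).
  assert (Ha2 : forall z, Cmod z < 1 -> cder a z (dx a z)).
  { intros z Hz; apply (holomorphic_derivative unit_disk h); auto.
    intros w Hw; apply Hha, disk_0, Hw. }
  assert (Hb2 : forall z, Cmod z < 1 -> cder b z (dx b z)).
  { intros z Hz; apply (holomorphic_derivative unit_disk g); auto.
    intros w Hw; apply Hha, disk_0, Hw. }
  assert (Ca : forall z, Cmod z < 1 -> continuous (dx a) z).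
  { intros z Hz; destruct (Ha1 z (D0 z Hz)) as (_ & _ & H & _); exact H. }
  assert (Cb : forall z, Cmod z < 1 -> continuous (dx b) z).
  { intros z Hz; destruct (Hb1 z (D0 z Hz)) as (_ & _ & H & _); exact H. }
  assert (Eb : forall z, Cmod (dzbar f z) = Cmod (b z))
    by (intros z; unfold b; now rewrite Cmod_conj).
  assert (HJ : forall z, Cmod z < 1 -> Cmod (b z) < Cmod (a z)).
  { intros z Hz; assert (H := Hsp z (D0 z Hz)); unfold jacobian in H; fold (a z) in H.
    rewrite Eb in H; assert (H1 := Cmod_ge_0 (a z)); assert (H2 := Cmod_ge_0 (b z)); nra. }
  (* Quasiregularity amounts to (K+1) |b| <= (K-1) |a|; add (K+1) |a|. *)
  assert (HQ : forall z, Cmod z < 1 -> (K + 1) * (Cmod (a z) + Cmod (b z)) <= 2 * K * Cmod (a z)).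
  { intros z Hz; assert (H := HK z (D0 z Hz)); assert (H1 := HJ z Hz).
    unfold Lambda, lambda in H; fold (a z) in H; rewrite Eb, Rabs_pos_eq in H; lra. }
  assert (H0 : Cmod 0 < 1) by (rewrite Cmod_0; lra).
  assert (Hab0 : Cmod (a 0) - Cmod (b 0) = 1).
  { unfold lambda in hlambda; fold (a 0) in hlambda; assert (H1 := HJ 0 H0).
    rewrite Eb, Rabs_pos_eq in hlambda; lra. }
  assert (HCauchy : forall z, Cmod z < 1 -> Cmod (a z) * (1 - Cmod z ^ 2) <= M).
  { intros z Hz; apply (cauchy_estimate h a M z); auto.
    - intros w Hw; apply Hha, Hw.
    - intros w Hw; eapply cder_continuous, Ha2, Hw. }
  (* At 0, |h'| = 1 + |g'| >= 1, while the Cauchy estimate gives |h'(0)| <= M. *)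
  assert (HM1 : 1 <= M).
  { assert (H := HCauchy 0 H0); rewrite Cmod_0 in H; assert (H1 := Cmod_ge_0 (b 0)); lra. }
  set (s := sqrt 3) in *; set (L := 3 * K * M / (K + 1)).
  assert (Hs : 0 < s) by (apply sqrt_lt_R0; lra).
  assert (Hss : s * s = 3) by (apply sqrt_sqrt; lra).
  assert (EL : L * (K + 1) = 3 * K * M) by (unfold L; field; lra).
  (* From M >= 1 and K >= 1, L is at least 3/2. Hence 1/L < 1, which keeps r2 below 1/sqrt 3, inside
     the region where L bounds the derivative. *)
  assert (HL : 1 < L) by nra.
  assert (Es : forall r, s * r < 1 -> 0 <= r -> r < 1 /\ 3 * r ^ 2 < 1).
  { intros r Hr Hr0; assert (1 < s) by nra; split; [nra|].
    replace (3 * r ^ 2) with ((s * r) * (s * r)) by (rewrite <- Hss; ring).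
    assert (0 <= s * r) by (apply Rmult_le_pos; lra); nra. }
  assert (Er2 : s * r2 = / L).
  { unfold r2, L; field; repeat split; lra. }
  assert (HL1 : / L < 1) by (rewrite <- Rinv_1; apply Rinv_lt_contravar; lra).
  assert (HL0 : 0 < / L) by (apply Rinv_0_lt_compat; lra).
  assert (Hr2 : 0 < r2) by nra.
  assert (Hr2s : forall r, r < r2 -> s * r < / L) by (intros r Hr; rewrite <- Er2; nra).
  assert (Hlow := directional_lower_bound a b (dx a) (dx b) s L Hs).
  assert (Hlow' : forall u, Cmod u = 1 -> exists v, Cmod v = 1 /\ forall z, s * Cmod z < 1 ->
    L * (1 - L * (s * Cmod z)) / (L - s * Cmod z) <= Re (v * (a z * u + Cconj (b z * u)))).
  { apply Hlow; try lra; intros z Hz; destruct (Es _ Hz (Cmod_ge_0 z)) as [Hz1 Hz2]; auto.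
    assert (H1 := HQ z Hz1); assert (H2 := HCauchy z Hz1); assert (H3 := Cmod_ge_0 (a z)).
    (* Here 1 - |z|^2 > 2/3. The factor 2K/(K+1) from quasiregularity then turns 3M/2 into L. *)
    assert (H4 : Cmod (a z) < 3 / 2 * M) by nra.
    apply Rmult_lt_reg_r with (K + 1); [lra|]; rewrite EL; nra. }
  clear Hlow.
  set (m := fun r => L * (1 - L * (s * r)) / (L - s * r)).
  (* With rho = s r one has m = L^2 - L (L^2 - 1) / (L - rho); P is its primitive vanishing at 0. At
     r2, where rho = 1/L, the linear term is 1 and the logarithm has argument 1 - 1/L^2. *)
  set (P := fun r => L / s * (L * (s * r) + (L ^ 2 - 1) * ln (1 - s * r / L))).
  assert (HD : forall r, r <= r2 -> s * r < 1).
  { intros r Hr; apply Rle_lt_trans with (/ L); [rewrite <- Er2; nra|exact HL1]. }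
  assert (HPd : forall r, r <= r2 -> is_derive P r (m r)).
  { intros r Hr; specialize (HD r Hr); unfold P, m; auto_derive.
    - apply Rlt_0_minus; apply Rmult_lt_reg_r with L; [lra|].
      unfold Rdiv; rewrite Rmult_assoc, Rinv_l; lra.
    - field; repeat split; lra. }
  assert (HP : P r2 = r3).
  { unfold P, r3; rewrite Er2; fold L.
    replace (L / s) with (s * K * M / (K + 1)).
    2:{ unfold L; apply Rmult_eq_reg_r with (s * (K + 1)); [|nra].
        replace (s * K * M / (K + 1) * (s * (K + 1))) with (s * s * K * M) by (field; lra).
        rewrite Hss; field; lra. }
    f_equal; rewrite Rinv_r by lra; do 4 f_equal; unfold L; field; lra. }
  rewrite <- HP.
  assert (Hsmall : forall z, Cmod z < r2 -> Cmod z < 1).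
  { intros z Hz; apply Es; [apply HD; lra|apply Cmod_ge_0]. }
  assert (Hf' : forall z, Cmod z < r2 -> f z = (h z + Cconj (g z))%C) by auto.
  assert (Hlow : forall u, Cmod u = 1 -> exists v, Cmod v = 1 /\
    forall z, Cmod z < r2 -> m (Cmod z) <= Re (v * (a z * u + Cconj (b z * u)))).
  { intros u Hu; destruct (Hlow' u Hu) as [v [Hv H]]; exists v; split; [exact Hv|].
    intros z Hz; apply H, HD; lra. }
  assert (Hm : forall r, 0 <= r < r2 -> 0 < m r).
  { intros r Hr; assert (H1 := Hr2s r ltac:(lra)).
    assert (H2 : L * (s * r) < 1).
    { replace 1 with (L * / L) by (field; lra); apply Rmult_lt_compat_l; lra. }
    apply Rdiv_lt_0_compat; [apply Rmult_lt_0_compat|]; lra. }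
  assert (Hmd : forall r t, 0 <= r <= t -> t < r2 -> m t <= m r).
  { intros r t Hrt Ht; assert (H1 := HD t ltac:(lra)); assert (H2 := HD r ltac:(lra)).
    assert (H3 : s * r <= s * t) by nra; unfold m.
    apply Rmult_le_reg_r with ((L - s * t) * (L - s * r)); [nra|].
    replace (L * (1 - L * (s * t)) / (L - s * t) * ((L - s * t) * (L - s * r)))
      with (L * ((1 - L * (s * t)) * (L - s * r))) by (field; lra).
    replace (L * (1 - L * (s * r)) / (L - s * r) * ((L - s * t) * (L - s * r)))
      with (L * ((1 - L * (s * r)) * (L - s * t))) by (field; lra).
    (* After cross-multiplication the difference of the two sides is (L^2 - 1) (s t - s r),
       nonnegative because L > 1. *)
    apply Rmult_le_compat_l; [lra|]; assert (1 < L ^ 2) by nra; nra. }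
  assert (HPc : continuous P r2).
  { apply (ex_derive_continuous P); eexists; apply HPd; lra. }
  assert (HP0 : P 0 = 0).
  { unfold P; replace (1 - s * 0 / L) with 1 by (field; lra); rewrite ln_1; ring. }
  assert (HPd' : forall r, 0 <= r < r2 -> is_derive P r (m r)) by (intros; apply HPd; lra).
  assert (Hhd : forall z, Cmod z < r2 -> cder h z (a z)) by (intros; apply Hha; auto).
  assert (Hgd : forall z, Cmod z < r2 -> cder g z (b z)) by (intros; apply Hha; auto).
  split; [|split].
  - exact HM1.
  - intros z1 z2 H1 H2; rewrite disk_0 in H1, H2.
    apply (f_univalent f h g a b r2 m); auto.
  - apply (f_contains_schlicht_disk f h g a b r2 m P); auto.
    apply Rlt_le; destruct (Es r2); lra.
Qed.
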